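(* Consider the multi-agent system $\dot x_i(t)=Ax_i(t)+Bu_i(t)$, $i\in\{1,\dots,N\}$, where $(A,B)$ is stabilizable and the signed graph $\mathcal G$ is connected and structurally balanced. Let $\kappa>0$ and let $P\in M_n(\mathbb R)$ be a (symmetric) positive definite matrix satisfying $A^TP+PA-\alpha(L)PBB^TP<-\kappa I_n$. Use the event-triggered protocol $u_i(t)=-K\sum_{j=1}^N|w_{ij}|(\hat x_i(t)-\mathrm{sgn}(w_{ij})\hat x_j(t))$ with $K:=B^TP$ and with the integral triggering rule defined in the context, where the constants $\beta_i>0$ are such that $\beta_{\max}:=\max_i\beta_i$ satisfies, for some $c>0$ with $\beta:=\kappa-c\|L_D\otimes PBB^TP\|^2>0$, $$\beta_{\max}<\min\left\{\frac{1}{2\|L_D\|^2},\ \frac{\beta c}{2\|L_D\|^2(\beta c+1)}\right\}.$$ Then for every $i\in\{1,\dots,N\}$ the function $t\mapsto\|\hat z_i(t)-z_i(t)\|$ is uniformly bounded for $t\ge0$.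
   Context: Notation: $\|\cdot\|$ is the Euclidean norm of vectors and the operator norm of matrices; $\otimes$ is the Kronecker product; $A\in M_n(\mathbb R)$, $B\in M_{n\times m}(\mathbb R)$; $x_i(t)\in\mathbb R^n$ and $u_i(t)\in\mathbb R^m$ are the state and control input of agent $i$. $(A,B)$ stabilizable means there is a matrix $K_1$ such that all eigenvalues of $A+BK_1$ have strictly negative real part. Graph: $\mathcal G=(\mathcal V,\mathcal E,\mathcal W)$ is an undirected signed graph with $\mathcal V=\{1,\dots,N\}$, $N\ge 2$, and symmetric signed weight matrix $\mathcal W=(w_{ij})\in M_N(\mathbb R)$, $w_{ij}\ne0$ iff $(j,i)\in\mathcal E$, $w_{ii}=0$. Its Laplacian is $L=C-\mathcal W$, $C=\mathrm{diag}(\sum_j|w_{1j}|,\dots,\sum_j|w_{Nj}|)$. $\mathcal G$ is structurally balanced if there is a bipartition $\mathcal V_1,\mathcal V_2$ of $\mathcal V$ with $w_{ij}\ge0$ for $i,j$ in the same part and $w_{ij}\le 0$ for $i,j$ in different parts. In that case (and $\mathcal G$ connected) fix $D=\mathrm{diag}(\sigma_1,\dots,\sigma_N)$, $\sigma_i\in\{1,-1\}$, such that all entries of $D\mathcal WD$ are nonnegative, and set $L_D:=DLD$. $\alpha(L)=\lambda_2(L)$ denotes the smallest positive eigenvalue of $L$. Event-triggered signals: agent $i$ has triggering instants $0=t^i_0\le t^i_1\le t^i_2\le\cdots$. For $t\ge 0$, $\hat x_i(t):=e^{(t-t^i_k)A}x_i(t^i_k)$ where $t^i_k$ is the latest triggering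 instant of agent $i$ with $t^i_k\le t$. Put $z_i=\sigma_ix_i$, $\hat z_i=\sigma_i\hat x_i$, $e_{z,i}=\hat z_i-z_i$. Triggering rule: let $h:[0,\infty)\to(0,\infty)$ be a fixed continuous function with $\int_0^\infty h(s)\,ds=1$, and let $\beta_i>0$ be constants. Define $$g_i(s)=\|e_{z,i}(s)\|^2-\beta_i\Bigl\|\sum_{j=1}^N|w_{ij}|(\hat z_i(s)-\hat z_j(s))\Bigr\|^2-\beta_ih(s),\qquad f_i^k(t)=\int_{t^i_k}^tg_i(s)\,ds,$$ and $t^i_{k+1}:=\inf\{t>t^i_k: f_i^k(t)>0\}$. Here $f_i^k$ is evaluated along the signals generated with no further triggering of agent $i$ after $t_k^i$ (so $f_i^k\le0$ on $[t^i_k,t^i_{k+1})$); $\inf\emptyset=+\infty$, in which case agent $i$ has no further triggering instants. The states $x_i$ are continuous and satisfy the differential equation between triggering instants, with arbitrary initial states. *)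

(* Defs.v *)
From mathcomp Require Import all_boot all_order all_algebra.
From mathcomp Require Import all_classical all_reals all_analysis.
From mathcomp Require Import complex mxtens.
Set Implicit Arguments.
Unset Strict Implicit.
Unset Printing Implicit Defensive.
Import Order.TTheory GRing.Theory Num.Theory.
Import numFieldNormedType.Exports.
Local Open Scope classical_set_scope.
Local Open Scope ring_scope.

Section LinearAlgebra.
Context {R : realType}.

(* The norm the library attaches to 'M[R]_(p, q) is the max norm, which induces
   the same topology; the Euclidean and operator norms are defined here. *)
Definition enorm p (v : 'cV[R]_p) : R := Num.sqrt (\sum_i v i 0 ^+ 2).

Definition opnorm p q (M : 'M[R]_(p, q)) : R :=
  sup [set enorm (M *m v) | v in [set v : 'cV[R]_q | enorm v <= 1]].

Definition expmx p (M : 'M[R]_p) : 'M[R]_p :=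
  limn (series (fun k : nat => (k`!%:R)^-1 *: M ^+ k)).

Definition posdefmx p (M : 'M[R]_p) : Prop :=
  M^T = M /\ forall v : 'cV[R]_p, v != 0 -> 0 < (v^T *m M *m v) 0 0.

Definition loewner_lt p (M1 M2 : 'M[R]_p) : Prop := posdefmx (M2 - M1).

Definition hurwitz p (M : 'M[R]_p) : Prop :=
  forall a : R[i], eigenvalue (map_mx (real_complex R) M) a -> complex.Re a < 0.

Definition stabilizable n m (A : 'M[R]_n) (B : 'M[R]_(n, m)) : Prop :=
  exists K1 : 'M[R]_(m, n), hurwitz (A + B *m K1).

(* A matrix has finitely many eigenvalues, so this infimum is a minimum as soon
   as there is a positive eigenvalue. *)
Definition min_pos_eigenvalue p (M : 'M[R]_p) : R :=
  inf [set a : R | 0 < a /\ eigenvalue M a].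

End LinearAlgebra.

Section SignedGraph.
Context {R : realType} {N : nat}.

Definition signed_weights (W : 'M[R]_N) : Prop :=
  W^T = W /\ forall i, W i i = 0.

Definition signed_connected (W : 'M[R]_N) : Prop :=
  forall i j, connect (fun a b : 'I_N => W b a != 0) i j.

(* The two parts are V1 and its complement; one of them may be empty, so that a
   graph without negative weights is structurally balanced. *)
Definition structurally_balanced (W : 'M[R]_N) : Prop :=
  exists V1 : {set 'I_N}, forall i j,
    ((i \in V1) = (j \in V1) -> 0 <= W i j) /\
    ((i \in V1) <> (j \in V1) -> W i j <= 0).

Definition laplacian (W : 'M[R]_N) : 'M[R]_N :=
  diag_mx (\row_i \sum_j `|W i j|) - W.

Definition gauge_mx (sigma : 'I_N -> R) : 'M[R]_N := diag_mx (\row_i sigma i).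

Definition gauge (W : 'M[R]_N) (sigma : 'I_N -> R) : Prop :=
  (forall i, sigma i = 1 \/ sigma i = -1) /\
  forall i j, 0 <= (gauge_mx sigma *m W *m gauge_mx sigma) i j.

Definition gauged_laplacian (W : 'M[R]_N) (sigma : 'I_N -> R) : 'M[R]_N :=
  gauge_mx sigma *m laplacian W *m gauge_mx sigma.

End SignedGraph.

Section EventTriggeredSystem.
Context {R : realType} {N n m : nat}.

(* [tau i k] is the k-th triggering instant of agent i; +oo means that there is
   no such instant. *)
Implicit Types (x : 'I_N -> R -> 'cV[R]_n) (tau : 'I_N -> nat -> \bar R).

Definition is_latest (ti : nat -> \bar R) (t : R) (k : nat) : Prop :=
  (ti k <= t%:E)%E /\ (t%:E < ti k.+1)%E.

Definition latest (ti : nat -> \bar R) (t : R) : nat :=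
  xget 0%N [set k | is_latest ti t k].

(* The times at which every agent has a latest triggering instant, i.e. at which
   the sampled signals exist: all of [0, +oo[ unless the instants of some agent
   accumulate at a finite time, and [0, T[ with T the first such time
   otherwise. *)
Definition signal_domain tau : set R :=
  [set t | 0 <= t /\ forall i, exists k, is_latest (tau i) t k].

Definition xhat (A : 'M[R]_n) x tau (i : 'I_N) (t : R) : 'cV[R]_n :=
  let s := fine (tau i (latest (tau i) t)) in expmx ((t - s) *: A) *m x i s.

Definition control (A : 'M[R]_n) (K : 'M[R]_(m, n)) (W : 'M[R]_N) x tau
    (i : 'I_N) (t : R) : 'cV[R]_m :=
  - (K *m \sum_j `|W i j| *:
       (xhat A x tau i t - Num.sg (W i j) *: xhat A x tau j t)).

Definition closed_loop (A : 'M[R]_n) (B : 'M[R]_(n, m)) (K : 'M[R]_(m, n))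
    (W : 'M[R]_N) x tau : Prop :=
  [/\ forall i, tau i 0%N = 0%E,
      forall i k, (tau i k <= tau i k.+1)%E,
      forall i, {within signal_domain tau, continuous (x i)} &
      forall i t, signal_domain tau t -> (forall j l, tau j l <> t%:E) ->
        is_derive t 1 (x i) (A *m x i t + B *m control A K W x tau i t)].

Section Trigger.
Variables (A : 'M[R]_n) (B : 'M[R]_(n, m)) (K : 'M[R]_(m, n)) (W : 'M[R]_N).
Variables (sigma beta : 'I_N -> R) (h : R -> R).

Definition zstate x i t : 'cV[R]_n := sigma i *: x i t.

Definition zhat x tau i t : 'cV[R]_n := sigma i *: xhat A x tau i t.

Definition zerror x tau i t : 'cV[R]_n := zhat x tau i t - zstate x i t.

Definition gfun x tau i s : R :=
  enorm (zerror x tau i s) ^+ 2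
  - beta i *
    enorm (\sum_j `|W i j| *: (zhat x tau i s - zhat x tau j s)) ^+ 2
  - beta i * h s.

Definition ffun x tau i k t : R :=
  \int[lebesgue_measure]_(s in `[fine (tau i k), t]) gfun x tau i s.

(* [(y, rho)] continues the trajectory [(x, tau)] with no triggering of agent i
   after its k-th instant. The two coincide before tau i k.+1; from then on the
   other agents may keep or drop their instants. Since the infimum in
   [trigger_rule] only depends on what happens immediately after tau i k.+1,
   this freedom only matters for agents triggering exactly at tau i k.+1, where
   it leaves open whether agent i takes such simultaneous triggerings into
   account. *)
Definition untriggered_continuation x tau i k y rho : Prop :=
  [/\ closed_loop A B K W y rho,
      forall l, rho i l = if (l <= k)%N then tau i l else +oo%E,
      forall j l, rho j l = tau j l \/
        (tau i k.+1 <= tau j l)%E /\ rho j l = +oo%E &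
      forall j t, 0 <= t -> (t%:E < tau i k.+1)%E -> y j t = x j t].

Definition trigger_rule x tau : Prop :=
  forall i k, (tau i k < +oo)%E ->
    exists y rho, untriggered_continuation x tau i k y rho /\
      tau i k.+1 = ereal_inf [set t%:E | t in
        [set t | [/\ signal_domain rho t, fine (tau i k) < t &
                     0 < ffun y rho i k t]]].

End Trigger.

End EventTriggeredSystem.

(* Main.v *)
Require Import Defs.
From mathcomp Require Import all_boot all_order all_algebra.
From mathcomp Require Import all_classical all_reals all_analysis.
From mathcomp Require Import complex mxtens.
From mathcomp Require Import measurable_realfun ring lra.
Set Implicit Arguments.
Unset Strict Implicit.
Unset Printing Implicit Defensive.
Import Order.TTheory GRing.Theory Num.Theory.
Import numFieldNormedType.Exports.
Local Open Scope classical_set_scope.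
Local Open Scope ring_scope.

(** After the gauge transformation z_i = sigma_i x_i the signed graph becomes an
    ordinary connected graph with weights |W i j|. With the states, the sampled
    signals and the sampling errors as the columns of n x N matrices Z, H and
    E = H - Z, and with L the gauged Laplacian, the closed loop reads
    Z' = A Z - B B^T P H L.

    The proof compares three integrals over [0, t]: those of |E|^2, of |H L|^2 and of
    |D|^2, where D is the disagreement, that is Z with the mean of its columns
    subtracted.
    - The triggering rule says that the error of each agent is dominated, in the
      integral, by its diffusion term and by h (trigger_total); hence the first
      integral is at most beta_max times the second plus a constant
      (intg_error_le).
    - As H L = (D + E) L, the second is at most 2 |L|^2 times the sum of the other
      two (fnorm2_diffusion_le).
    - V = trace (D^T P D) satisfies V' <= - b |D|^2 + |E|^2 / c. This combines the
      matrix inequality for P with the spectral gap of L on sum-zero vectors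
      (lyapunov_derivative_le, spectral_gap). As V >= 0, b times the third integral
      is at most 1 / c times the first plus a constant (lyapunov_decrease).
    The smallness of beta_max is exactly what makes this loop of inequalities
    contractive, so the first two integrals are bounded uniformly in t (small_gain,
    integral_bounds).

    A pointwise bound follows because the error of an agent restarts from 0 at each
    of its instants: between instants it solves a linear equation driven by its
    diffusion term, so its square at time t is at most a constant times the integrals
    of the squared error and of the squared diffusion term since the latest instant
    (error_growth).

    Derivatives and continuity fail only at the instants, of which finitely many
    precede any time of the signal domain; le_increment_intg integrates a
    differential inequality across such exceptions. *)

(** * Integrals of bounded measurable functions *)

Section BoundedMeasurable.
Context {R : realType}.
Implicit Types (a b s t : R) (f g : R -> R).
Notation mu := (@lebesgue_measure R).

(** The signals of the system are smooth between the triggering instants and have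
    jumps there. Bounded measurable functions form an algebra that contains them
    and on which the integral is linear, with no partition to keep track of. *)
Definition bmeas a b f :=
  measurable_fun (`[a, b]%classic : set (measurableTypeR R)) f /\
  exists M, forall t, a <= t <= b -> `|f t| <= M.

Lemma bmeas_ext a b f g :
  (forall t, a <= t <= b -> f t = g t) -> bmeas a b f -> bmeas a b g.
Proof.
move=> fg [mf [M fM]]; split; last by exists M => t tab; rewrite -fg// fM.
apply: eq_measurable_fun mf => t; rewrite inE/= in_itv/= => tab.
exact: fg.
Qed.

Lemma bmeas_cst a b c : bmeas a b (fun=> c).
Proof. by split; [exact: measurable_cst | exists `|c|]. Qed.

Lemma bmeasD a b f g :
  bmeas a b f -> bmeas a b g -> bmeas a b (fun t => f t + g t).
Proof.
move=> [mf [M fM]] [mg [L gL]]; split; first exact: measurable_funD.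
exists (M + L) => t tab; apply: le_trans (ler_normD _ _) _.
by rewrite lerD ?fM ?gL.
Qed.

Lemma bmeasM a b f g :
  bmeas a b f -> bmeas a b g -> bmeas a b (fun t => f t * g t).
Proof.
move=> [mf [M fM]] [mg [L gL]]; split; first exact: measurable_funM.
by exists (M * L) => t tab; rewrite normrM ler_pM ?fM ?gL.
Qed.

Lemma bmeasZ a b c f : bmeas a b f -> bmeas a b (fun t => c * f t).
Proof. exact/bmeasM/bmeas_cst. Qed.

Lemma bmeasB a b f g :
  bmeas a b f -> bmeas a b g -> bmeas a b (fun t => f t - g t).
Proof.
move=> hf hg; apply: (bmeasD hf).
by apply: bmeas_ext (bmeasZ (-1) hg) => t _; rewrite mulN1r.
Qed.

Lemma bmeas_sum a b (I : Type) (r : seq I) (F : I -> R -> R) :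
  (forall i, bmeas a b (F i)) -> bmeas a b (fun t => \sum_(i <- r) F i t).
Proof.
move=> hF; elim: r => [|i r ih].
  by apply: bmeas_ext (bmeas_cst a b 0) => t _; rewrite big_nil.
by apply: bmeas_ext (bmeasD (hF i) ih) => t _; rewrite big_cons.
Qed.

Lemma continuous_bmeas a b f : {within `[a, b], continuous f} -> bmeas a b f.
Proof.
move=> cf; split; first exact: subspace_continuous_measurable_fun.
have [M [_ fM]] := compact_bounded (continuous_compact cf (@segment_compact R a b)).
exists (M + 1) => t tab; apply: (fM (M + 1)); first by rewrite ltrDl.
by exists t => //=; rewrite in_itv.
Qed.

Lemma bmeas_indic a b (D : set R) : measurable (D : set (measurableTypeR R)) ->
  bmeas a b \1_D.
Proof.
move=> mD; split; first exact: measurable_indic.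
exists 1 => t _; rewrite indicE; case: (_ \in _); by rewrite ?normr1 ?normr0.
Qed.

Lemma bmeasS a b a' b' f : a <= a' -> b' <= b -> bmeas a b f -> bmeas a' b' f.
Proof.
move=> aa bb [mf [M fM]]; split; last first.
  exists M => t /andP[ta tb]; apply: fM.
  by rewrite (le_trans aa)// (le_trans tb).
apply: measurable_funS mf => //.
by apply: subset_itv; rewrite bnd_simp.
Qed.

Lemma bmeas_integrable a b f : bmeas a b f ->
  mu.-integrable `[a, b] (EFin \o f).
Proof.
move=> [mf [M fM]]; apply: measurable_bounded_integrable => //.
  by rewrite /= lebesgue_measure_itv/=; case: ifP => // _; rewrite -EFinB ltry.
exists M; split; first exact: num_real.
by move=> x Mx t /=; rewrite in_itv/= => /fM /le_trans; apply; exact: ltW.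
Qed.

Definition intg a b f : R := \int[mu]_(t in `[a, b]) f t.

Lemma intgD a b f g : bmeas a b f -> bmeas a b g ->
  intg a b (fun t => f t + g t) = intg a b f + intg a b g.
Proof. by move=> hf hg; apply: RintegralD => //; exact: bmeas_integrable. Qed.

Lemma intgB a b f g : bmeas a b f -> bmeas a b g ->
  intg a b (fun t => f t - g t) = intg a b f - intg a b g.
Proof. by move=> hf hg; apply: RintegralB => //; exact: bmeas_integrable. Qed.

Lemma intgZ a b c f : bmeas a b f ->
  intg a b (fun t => c * f t) = c * intg a b f.
Proof. by move=> hf; apply: RintegralZl => //; exact: bmeas_integrable. Qed.

Lemma intg_sum a b (I : Type) (r : seq I) (F : I -> R -> R) :
  (forall i, bmeas a b (F i)) ->
  intg a b (fun t => \sum_(i <- r) F i t) = \sum_(i <- r) intg a b (F i).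
Proof.
move=> hF; elim: r => [|i r ih].
  rewrite big_nil /intg; under eq_Rintegral do rewrite big_nil.
  by rewrite Rintegral_cst// mul0r.
rewrite big_cons -ih -intgD//; last exact: bmeas_sum.
by apply: eq_Rintegral => t _; rewrite big_cons.
Qed.

Lemma eq_intg a b f g : (forall t, a <= t <= b -> f t = g t) ->
  intg a b f = intg a b g.
Proof.
by move=> fg; apply: eq_Rintegral => t; rewrite inE/= in_itv/=; exact: fg.
Qed.

Lemma le_intg a b f g : bmeas a b f -> bmeas a b g ->
  (forall t, a <= t <= b -> f t <= g t) -> intg a b f <= intg a b g.
Proof.
move=> hf hg fg; apply: le_Rintegral => //; exact: bmeas_integrable.
Qed.

Lemma intg_ge0 a b f : (forall t, a <= t <= b -> 0 <= f t) -> 0 <= intg a b f.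
Proof.
by move=> f0; apply: Rintegral_ge0 => t/=; rewrite in_itv/=; exact: f0.
Qed.

Lemma intg_point a f : intg a a f = 0.
Proof. by rewrite /intg set_itv1 Rintegral_set1. Qed.

Lemma intg_split a s b f : a <= s <= b -> bmeas a b f ->
  intg a b f = intg a s f + intg s b f.
Proof.
move=> /andP[as_ sb] hf; apply/eqP; rewrite addrC -subr_eq; apply/eqP.
rewrite /intg Rintegral_itvB ?bnd_simp//; last exact: bmeas_integrable.
rewrite Rintegral_itv_obnd_cbnd//.
apply: integrableS (bmeas_integrable hf) => //.
by apply: subset_itv; rewrite bnd_simp.
Qed.

Lemma le_intg_sub a s t b f : a <= s -> s <= t -> t <= b -> bmeas a b f ->
  (forall t, a <= t <= b -> 0 <= f t) -> intg s t f <= intg a b f.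
Proof.
move=> as_ st tb hf f0.
rewrite (@intg_split a s b)//; last by rewrite as_ (le_trans st).
rewrite (@intg_split s t b) ?st//; last exact: bmeasS hf.
rewrite addrCA lerDl addr_ge0 ?intg_ge0// => u /andP[u1 u2]; apply: f0.
  by rewrite u1 (le_trans u2)// (le_trans st).
by rewrite u2 andbT (le_trans as_)// (le_trans st).
Qed.

Lemma intg_continuous a b f : a <= b -> bmeas a b f ->
  {within `[a, b], continuous (fun t => intg a t f)}.
Proof.
by move=> ab hf; apply: parameterized_integral_continuous (bmeas_integrable hf).
Qed.

(** Induction on the exceptional points: one that lies inside the interval splits
    it into two intervals with fewer exceptions; when none is left, the mean value
    theorem applies. *)
Lemma nonincreasing_endpoints_except a b f (S : seq R) : a <= b ->
  {within `[a, b], continuous f} ->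
  (forall t, a < t < b -> t \notin S -> derivable f t 1 /\ 'D_1 f t <= 0) ->
  f b <= f a.
Proof.
elim: S a b => [|s S ih] a b ab cf df.
  apply: (@ler0_derive1_le_cc _ f a b) => //; rewrite ?in_itv/= ?lexx ?ab//.
  - by move=> t; rewrite in_itv/= => /df[].
  - by move=> t; rewrite in_itv/= derive1E => /df[].
have [/andP[as_ sb]|sab] := boolP (a < s < b).
  apply: (@le_trans _ _ (f s)).
    apply: ih; first exact: ltW.
      by apply: continuous_subspaceW cf; apply: subset_itv; rewrite bnd_simp// ltW.
    move=> t /andP[st tb] tS; apply: df; first by rewrite tb (lt_trans as_).
    by rewrite inE negb_or tS gt_eqF.
  apply: ih; first exact: ltW.
    by apply: continuous_subspaceW cf; apply: subset_itv; rewrite bnd_simp// ltW.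
  move=> t /andP[at_ ts] tS; apply: df; first by rewrite at_ (lt_trans ts).
  by rewrite inE negb_or tS lt_eqF.
apply: ih => // t tab tS; apply: df => //; rewrite inE negb_or tS andbT.
by apply: contra sab => /eqP <-.
Qed.

(** At a point of continuity of G, the fundamental theorem of calculus says that
    F minus the primitive of G has derivative dF - G, which is nonpositive. *)
Lemma le_increment_intg a b (F dF : R -> R) G (S : seq R) : a <= b ->
  {within `[a, b], continuous F} -> bmeas a b G ->
  (forall t, a < t < b -> t \notin S ->
     [/\ is_derive t 1 F (dF t), dF t <= G t & {for t, continuous G}]) ->
  F b - F a <= intg a b G.
Proof.
move=> ab cF hG H.
suff : F b - intg a b G <= F a - intg a a G.
  by rewrite intg_point subr0 lerBlDr addrC -lerBlDr.
pose f t := F t - intg a t G.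
apply: (@nonincreasing_endpoints_except a b f S) => //.
  by move=> t; apply: cvgB; [exact: cF|exact: intg_continuous].
move=> t tab tS; have [dFt FG cG] := H t tab tS.
have /andP[at_ tb] := tab.
have [dI I'] := continuous_FTC1_closed tb (bmeas_integrable hG) at_ cG.
have dF1 : derivable F t 1 by [].
split; first exact: derivableB.
by rewrite deriveB// -[X in _ - X]derive1E I' derive_val subr_le0.
Qed.

Lemma le_at_right_end a b f c : a < b -> {within `[a, b], continuous f} ->
  (forall t, a < t < b -> f t <= c) -> f b <= c.
Proof.
move=> ab /(continuous_within_itvP _ ab)[_ _ fb] fc.
apply: (cvgr_to_le fb); near=> t; apply: fc.
by apply/andP; split; near: t; [exact: nbhs_left_gt|exact: nbhs_left_lt].
Unshelve. all: by end_near. Qed.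

End BoundedMeasurable.

(** * Derivatives of matrix-valued functions *)

Section MatrixDerivative.
Context {R : realType}.

Lemma is_derive_mxP p q (M : R -> 'M[R]_(p, q)) (t : R) (dM : 'M[R]_(p, q)) :
  is_derive t 1 M dM <->
  forall i j, is_derive t 1 (fun s => M s i j) (dM i j).
Proof.
split=> [[dMt <-] i j|H].
  apply: DeriveDef; first by move/derivable_mxP : dMt; exact.
  by rewrite derive_mx// mxE.
have dMt : derivable M t 1 by apply/derivable_mxP => i j; have [] := H i j.
apply: DeriveDef => //; rewrite derive_mx//; apply/matrixP => i j.
by rewrite mxE; have [_ <-] := H i j.
Qed.

Lemma is_derive_bigsum n (f : 'I_n -> R -> R) (df : 'I_n -> R) (t : R) :
  (forall i, is_derive t 1 (f i) (df i)) ->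
  is_derive t 1 (fun s => \sum_i f i s) (\sum_i df i).
Proof.
move=> H; have := is_derive_sum H.
rewrite (_ : \sum_i f i = fun s => \sum_i f i s)//.
by apply/funext => s; rewrite fct_sumE.
Qed.

Lemma is_derive_mulmx p q r (M : R -> 'M[R]_(p, q)) (M' : R -> 'M[R]_(q, r))
    (t : R) dM dM' : is_derive t 1 M dM -> is_derive t 1 M' dM' ->
  is_derive t 1 (fun s => M s *m M' s) (dM *m M' t + M t *m dM').
Proof.
move=> /is_derive_mxP dMt /is_derive_mxP dMt'; apply/is_derive_mxP => i j.
under eq_fun do rewrite mxE.
rewrite !mxE -big_split; apply: is_derive_bigsum => k.
have := @is_deriveM R R^o (fun s => M s i k) (fun s => M' s k j) t 1 _ _
  (dMt i k) (dMt' k j).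
by rewrite [X in is_derive _ _ _ X](_ : _ = dM i k * M' t k j + M t i k * dM' k j)//
  addrC; congr (_ + _); rewrite [LHS]mulrC.
Qed.

Lemma is_derive_trmx p q (M : R -> 'M[R]_(p, q)) (t : R) dM : is_derive t 1 M dM ->
  is_derive t 1 (fun s => (M s)^T) dM^T.
Proof.
move=> /is_derive_mxP dMt; apply/is_derive_mxP => i j.
by rewrite mxE; under eq_fun do rewrite mxE.
Qed.

Lemma is_derive_mxtrace p (M : R -> 'M[R]_p) (t : R) dM : is_derive t 1 M dM ->
  is_derive t 1 (fun s => \tr (M s)) (\tr dM).
Proof. by move=> /is_derive_mxP dMt; exact: is_derive_bigsum. Qed.

Lemma is_derive_mulmxl p q r (A : 'M[R]_(p, q)) (M : R -> 'M[R]_(q, r)) (t : R) dM :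
  is_derive t 1 M dM -> is_derive t 1 (fun s => A *m M s) (A *m dM).
Proof.
move=> dMt; have := is_derive_mulmx (is_derive_cst A t 1) dMt.
by rewrite mul0mx add0r.
Qed.

Lemma is_derive_mulmxr p q r (M : R -> 'M[R]_(p, q)) (A : 'M[R]_(q, r)) (t : R) dM :
  is_derive t 1 M dM -> is_derive t 1 (fun s => M s *m A) (dM *m A).
Proof.
move=> dMt; have := is_derive_mulmx dMt (is_derive_cst A t 1).
by rewrite mulmx0 addr0.
Qed.

End MatrixDerivative.

(** * The matrix exponential *)

Section MatrixExponential.
Context {R : realType}.

Lemma cvg_mx p q (u : nat -> 'M[R]_(p, q)) (l : 'M[R]_(p, q)) :
  (forall i j, (fun k => u k i j) @ \oo --> l i j) -> u @ \oo --> l.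
Proof.
move=> H; apply/cvgrPdist_le => e e0; near=> k.
rewrite /Num.Def.normr/= mx_normrE (bigmax_le _ (ltW e0))//= => i _.
rewrite !mxE; move: i; near: k; apply: filter_forall => /= i.
exact: ((cvgrPdist_le _ _).1 (H i.1 i.2)).
Unshelve. all: by end_near. Qed.

Lemma cvg_bigsum n (u : 'I_n -> nat -> R) (l : 'I_n -> R) :
  (forall i, u i @ \oo --> l i) ->
  (fun k => \sum_i u i k) @ \oo --> \sum_i l i.
Proof.
move=> H; rewrite (_ : (fun _ => _) = \sum_i u i); last first.
  by apply/funext => k; rewrite fct_sumE.
elim/big_ind2 : _ => //; first exact: cvg_cst.
by move=> f a g b fa gb; exact: cvgD.
Qed.

Variables (p : nat) (A : 'M[R]_p).

Lemma exprZmx (c : R) k : (c *: A) ^+ k = c ^+ k *: A ^+ k.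
Proof.
elim: k => [|k ih]; first by rewrite !expr0 scale1r.
by rewrite !exprS ih -[LHS]/(_ *m _) -scalemxAl -scalemxAr scalerA.
Qed.

(** Coefficients of the power series in t of the (i, j) entry of A ^ d exp (t A).
    With the extra power of A, this family of series is stable under formal
    differentiation, which merely increments d. *)
Definition expmx_coef (d : nat) i j (k : nat) : R := (A ^+ (k + d)) i j / k`!%:R.

Lemma expmx_coef_diffs d i j : pseries_diffs (expmx_coef d i j) = expmx_coef d.+1 i j.
Proof.
apply/funext => k; rewrite /pseries_diffs /expmx_coef addSnnS factS natrM invfM.
by rewrite mulrCA mulVKf.
Qed.

Let C : R := \sum_i \sum_j `|A i j|.

(** C, the sum of the absolute values of all entries, bounds the sums over each
    column, so one more factor A costs one more factor C. *)
Lemma expmx_entry_le k i j : `|(A ^+ k) i j| <= C ^+ k.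
Proof.
elim: k i j => [|k ih] i j.
  by rewrite !expr0 mxE; case: eqP; rewrite ?normr1 ?normr0.
rewrite !exprSr mxE; apply: le_trans (ler_norm_sum _ _ _) _.
have C0 : 0 <= C by apply: sumr_ge0 => ? _; exact: sumr_ge0.
apply: (@le_trans _ _ (\sum_l C ^+ k * `|A l j|)).
  by apply: ler_sum => l _; rewrite normrM ler_wpM2r.
rewrite -mulr_sumr ler_wpM2l ?exprn_ge0//; apply: ler_sum => l _.
by rewrite (bigD1 j)//= lerDl sumr_ge0.
Qed.

(** The series is dominated by C ^ d times the series of exp (C |t|). *)
Lemma expmx_coef_cvg d i j t : cvgn (pseries (expmx_coef d i j) t).
Proof.
have C0 : 0 <= C by apply: sumr_ge0 => ? _; exact: sumr_ge0.
apply: normed_cvg.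
apply: (@series_le_cvg _ _ (fun k => C ^+ d * exp_coeff (C * `|t|) k)) => //.
- by move=> k /=.
- move=> k; rewrite /exp_coeff/= mulr_ge0 ?exprn_ge0// divr_ge0//.
  by rewrite exprn_ge0// mulr_ge0.
- move=> k; rewrite /exp_coeff/= normrM normrX /expmx_coef normrM.
  rewrite normfV normr_nat [X in _ <= X](_ : _ = C ^+ (k + d) / k`!%:R * `|t| ^+ k).
    by rewrite ler_wpM2r ?exprn_ge0// ler_wpM2r// expmx_entry_le.
  by rewrite exprD exprMn; lra.
- apply: is_cvg_seriesZ; exact: is_cvg_series_exp_coeff.
Qed.

Definition expmx_entry d i j (t : R) : R := limn (pseries (expmx_coef d i j) t).

Lemma expmx_entryE t i j : expmx (t *: A) i j = expmx_entry 0 i j t.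
Proof.
rewrite /expmx; set S := series _.
suff H : S @ \oo --> \matrix_(i, j) expmx_entry 0 i j t.
  by rewrite (cvg_lim _ H)// mxE.
apply: cvg_mx => {i j} i j; rewrite mxE.
rewrite (_ : (fun k => _) = pseries (expmx_coef 0 i j) t); first exact: expmx_coef_cvg.
apply/funext => k; rewrite /S /pseries /series/= summxE; apply: eq_bigr => l _.
rewrite mxE exprZmx mxE /expmx_coef addn0; lra.
Qed.

Lemma expmx_entryS d i j t :
  expmx_entry d.+1 i j t = \sum_l A i l * expmx_entry d l j t.
Proof.
apply: cvg_lim => //.
rewrite (_ : pseries _ t = fun k => \sum_l A i l * pseries (expmx_coef d l j) t k).
  by apply: cvg_bigsum => l; apply: cvgMr; exact: expmx_coef_cvg.
apply/funext => k; rewrite /pseries/=.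
under [RHS]eq_bigr do rewrite mulr_sumr.
rewrite exchange_big/=; apply: eq_bigr => m _.
rewrite /expmx_coef addnS exprS mxE !mulr_suml; apply: eq_bigr => l _; lra.
Qed.

Lemma is_derive_expmx_entry d i j (t : R) :
  is_derive t 1 (expmx_entry d i j) (expmx_entry d.+1 i j t).
Proof.
rewrite /expmx_entry -expmx_coef_diffs.
apply: (@pseries_snd_diffs _ _ (`|t| + 1)); rewrite ?expmx_coef_diffs;
  try exact: expmx_coef_cvg.
by rewrite [ltRHS]ger0_norm ?addr_ge0// ltrDl.
Qed.

Lemma is_derive_expmx (t : R) :
  is_derive t 1 (fun s => expmx (s *: A)) (A *m expmx (t *: A)).
Proof.
apply/is_derive_mxP => i j; under eq_fun do rewrite expmx_entryE.
rewrite mxE; under eq_bigr do rewrite expmx_entryE.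
rewrite -expmx_entryS; exact: is_derive_expmx_entry.
Qed.

Lemma expmx0 : expmx (0 *: A) = 1%:M.
Proof.
apply/matrixP => i j; rewrite expmx_entryE; apply: cvg_lim => //.
apply: (@cvg_trans _ (cst (1%:M i j : R) @ \oo)); last exact: cvg_cst.
apply: near_eq_cvg; exists 1%N => // -[//|k] _ /=.
rewrite /pseries /series/= big_nat_recl//= big1 => [|l _]; last by rewrite expr0n mulr0.
by rewrite /expmx_coef !expr0 fact0 divr1 mulr1 addr0.
Qed.

End MatrixExponential.

(** * Euclidean, Frobenius and operator norms *)

Section Norms.
Context {R : realType}.

(** In the matrices used below, the column j carries a signal of agent j. *)
Definition cnorm2 p q (M : 'M[R]_(p, q)) j : R := \sum_i M i j ^+ 2.
Definition fnorm2 p q (M : 'M[R]_(p, q)) : R := \sum_j cnorm2 M j.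

Lemma cnorm2_ge0 p q (M : 'M[R]_(p, q)) j : 0 <= cnorm2 M j.
Proof. by apply: sumr_ge0 => i _; exact: sqr_ge0. Qed.

Lemma fnorm2_ge0 p q (M : 'M[R]_(p, q)) : 0 <= fnorm2 M.
Proof. by apply: sumr_ge0 => i _; exact: cnorm2_ge0. Qed.

Lemma cnorm2_le_fnorm2 p q (M : 'M[R]_(p, q)) j : cnorm2 M j <= fnorm2 M.
Proof.
by rewrite /fnorm2 (bigD1 j)//= lerDl; apply: sumr_ge0 => i _; exact: cnorm2_ge0.
Qed.

Lemma cnorm2_col p q (M : 'M[R]_(p, q)) j : cnorm2 (col j M) 0 = cnorm2 M j.
Proof. by apply: eq_bigr => i _; rewrite mxE. Qed.

Lemma cnorm2_eq0 p (v : 'cV[R]_p) : cnorm2 v 0 = 0 -> v = 0.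
Proof.
move=> /psumr_eq0P v0; apply/matrixP => i j; rewrite ord1 mxE.
by apply/eqP; rewrite -sqrf_eq0 v0// => k _; exact: sqr_ge0.
Qed.

Lemma fnorm2_tr p q (M : 'M[R]_(p, q)) : fnorm2 M^T = fnorm2 M.
Proof.
rewrite /fnorm2 /cnorm2 exchange_big; apply: eq_bigr => i _.
by apply: eq_bigr => j _; rewrite mxE.
Qed.

Lemma cnorm2_tr p q (M : 'M[R]_(p, q)) j : cnorm2 M j = (M^T *m M) j j.
Proof. by rewrite mxE; apply: eq_bigr => i _; rewrite mxE expr2. Qed.

Lemma fnorm2_trace p q (M : 'M[R]_(p, q)) : fnorm2 M = \tr (M^T *m M).
Proof. by apply: eq_bigr => i _; exact: cnorm2_tr. Qed.

Lemma mxtrace_trmx_mul p q (M M' : 'M[R]_(p, q)) :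
  \tr (M^T *m M') = \sum_j \sum_i M i j * M' i j.
Proof.
by apply: eq_bigr => j _; rewrite mxE; apply: eq_bigr => i _; rewrite mxE.
Qed.

Lemma cnorm2D p q (M M' : 'M[R]_(p, q)) j :
  cnorm2 (M + M') j <= 2 * cnorm2 M j + 2 * cnorm2 M' j.
Proof.
rewrite /cnorm2 !mulr_sumr -big_split; apply: ler_sum => i _ /=.
by rewrite mxE; have := sqr_ge0 (M i j - M' i j); lra.
Qed.

Lemma fnorm2D p q (M M' : 'M[R]_(p, q)) :
  fnorm2 (M + M') <= 2 * fnorm2 M + 2 * fnorm2 M'.
Proof.
rewrite /fnorm2 !mulr_sumr -big_split; apply: ler_sum => j _ /=.
exact: cnorm2D.
Qed.

(** Entrywise, the difference of the two sides is (c x + y) ^ 2 / c. *)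
Lemma young_trace p q (M M' : 'M[R]_(p, q)) c : 0 < c ->
  - 2 * \tr (M^T *m M') <= c * fnorm2 M + fnorm2 M' / c.
Proof.
move=> c0; rewrite mxtrace_trmx_mul /fnorm2 mulr_suml !mulr_sumr -big_split/=.
apply: ler_sum => j _; rewrite /cnorm2 mulr_suml !mulr_sumr -big_split/=.
apply: ler_sum => i _; rewrite -subr_ge0.
rewrite (_ : _ - _ = (c * M i j + M' i j) ^+ 2 / c).
  by rewrite divr_ge0 ?sqr_ge0// ltW.
by field; rewrite gt_eqF.
Qed.

Lemma enorm_ge0 p (v : 'cV[R]_p) : 0 <= enorm v.
Proof. exact: sqrtr_ge0. Qed.

Lemma enorm_sqr p (v : 'cV[R]_p) : enorm v ^+ 2 = cnorm2 v 0.
Proof. by rewrite sqr_sqrtr// cnorm2_ge0. Qed.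

(** Without an upper bound the supremum defining the operator norm would be the
    default value of sup. A vector of norm at most 1 has entries at most 1, hence a
    bound by the sums of the absolute values along the rows. *)
Lemma opnorm_ubound p q (M : 'M[R]_(p, q)) :
  has_ubound [set enorm (M *m v) | v in [set v : 'cV[R]_q | enorm v <= 1]].
Proof.
exists (Num.sqrt (\sum_i (\sum_j `|M i j|) ^+ 2)) => _ [v /= v1 <-].
apply: ler_wsqrtr; apply: ler_sum => i _.
rewrite -[leLHS]real_normK ?num_real// ler_pXn2r ?nnegrE ?sumr_ge0//.
rewrite mxE (le_trans (ler_norm_sum _ _ _))//; apply: ler_sum => j _.
rewrite normrM ler_piMr// (le_trans _ v1)// -sqrtr_sqr ler_wsqrtr//.
by rewrite (bigD1 j)//= lerDl sumr_ge0// => k _; exact: sqr_ge0.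
Qed.

Lemma opnorm_ge0 p q (M : 'M[R]_(p, q)) : 0 <= opnorm M.
Proof.
apply: le_trans (enorm_ge0 (M *m 0)) _.
apply: (ub_le_sup (opnorm_ubound M)); exists 0 => //=.
rewrite /enorm big1 ?sqrtr0// => i _; by rewrite mxE expr0n.
Qed.

Lemma cnorm2_mulmx_cV p q (M : 'M[R]_(p, q)) (v : 'cV[R]_q) :
  cnorm2 (M *m v) 0 <= opnorm M ^+ 2 * cnorm2 v 0.
Proof.
have [->|v0] := eqVneq v 0.
  have -> : cnorm2 (M *m 0) (0 : 'I_1) = 0.
    by rewrite mulmx0; apply: big1 => i _; rewrite mxE expr0n.
  by rewrite mulr_ge0 ?cnorm2_ge0// exprn_ge0// opnorm_ge0.
have nv0 : 0 < enorm v.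
  rewrite lt0r enorm_ge0 andbT; apply: contra v0 => /eqP v0.
  by apply/eqP/cnorm2_eq0; rewrite -enorm_sqr v0 expr0n.
rewrite -!enorm_sqr -exprMn ler_pXn2r ?nnegrE ?enorm_ge0//; last first.
  by rewrite mulr_ge0 ?enorm_ge0// opnorm_ge0.
have enormZ k c (w : 'cV[R]_k) : 0 <= c -> enorm (c *: w) = c * enorm w.
  move=> c0; rewrite /enorm -{2}(ger0_norm c0) -sqrtr_sqr -sqrtrM ?sqr_ge0//.
  by rewrite mulr_sumr; congr Num.sqrt; apply: eq_bigr => i _; rewrite mxE exprMn.
have : enorm (M *m ((enorm v)^-1 *: v)) <= opnorm M.
  apply: (ub_le_sup (opnorm_ubound M)); exists ((enorm v)^-1 *: v) => //=.
  by rewrite enormZ ?invr_ge0 ?enorm_ge0// mulVf// gt_eqF.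
rewrite -scalemxAr enormZ ?invr_ge0 ?enorm_ge0//.
by rewrite ler_pdivrMl// mulrC.
Qed.

Lemma cnorm2_mulmx p q r (M : 'M[R]_(p, q)) (X : 'M[R]_(q, r)) j :
  cnorm2 (M *m X) j <= opnorm M ^+ 2 * cnorm2 X j.
Proof. by rewrite -cnorm2_col -(cnorm2_col X) !colE -mulmxA cnorm2_mulmx_cV. Qed.

Lemma fnorm2_mulmx p q r (M : 'M[R]_(p, q)) (X : 'M[R]_(q, r)) :
  fnorm2 (M *m X) <= opnorm M ^+ 2 * fnorm2 X.
Proof. by rewrite /fnorm2 mulr_sumr; apply: ler_sum => j _; exact: cnorm2_mulmx. Qed.

Lemma sum_mxtens p q (F : 'I_(p * q) -> R) :
  \sum_k F k = \sum_i \sum_j F (mxtens_index (i, j)).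
Proof.
rewrite (reindex (@mxtens_index p q))/=; last first.
  by exists (@mxtens_unindex p q) => x _; rewrite ?mxtens_indexK ?mxtens_unindexK.
by rewrite pair_bigA/=; apply: eq_bigr => -[].
Qed.

(** The vector obtained by stacking the columns, with the indexing of the Kronecker
    product. *)
Definition vecmx p q (X : 'M[R]_(q, p)) : 'cV[R]_(p * q) :=
  \col_k X (mxtens_unindex k).2 (mxtens_unindex k).1.

Lemma cnorm2_vecmx p q (X : 'M[R]_(q, p)) : cnorm2 (vecmx X) 0 = fnorm2 X.
Proof.
rewrite /cnorm2 sum_mxtens; apply: eq_bigr => j _; apply: eq_bigr => i _.
by rewrite mxE mxtens_indexK.
Qed.

(** On stacked columns, the Kronecker product acts as a two-sided multiplication;
    this is what turns the operator norm of a Kronecker product into an estimate on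
    matrices. *)
Lemma tensmx_vec p q p' q' (L : 'M[R]_(p', p)) (Q : 'M[R]_(q', q))
    (X : 'M[R]_(q, p)) : (L *t Q) *m vecmx X = vecmx (Q *m X *m L^T).
Proof.
apply/colP => k; case: (mxtens_indexP k) => i j {k}.
rewrite !mxE mxtens_indexK/= sum_mxtens; apply: eq_bigr => l _.
rewrite !mxE mulr_suml; apply: eq_bigr => a _.
by rewrite tensmxE mxE mxtens_indexK/= mulrAC mulrC mulrA mulrAC.
Qed.

Lemma fnorm2_kron p q p' q' (L : 'M[R]_(p', p)) (Q : 'M[R]_(q', q))
    (X : 'M[R]_(q, p)) :
  fnorm2 (Q *m X *m L^T) <= opnorm (L *t Q) ^+ 2 * fnorm2 X.
Proof. by rewrite -cnorm2_vecmx -(cnorm2_vecmx X) -tensmx_vec cnorm2_mulmx_cV. Qed.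

(** The trace is the sum of the values of the form on the columns. *)
Lemma trace_form_ge0 p q (M : 'M[R]_p) (X : 'M[R]_(p, q)) :
  (forall v : 'cV[R]_p, 0 <= (v^T *m M *m v) 0 0) -> 0 <= \tr (X^T *m M *m X).
Proof.
move=> M0; apply: sumr_ge0 => j _; apply: le_trans (M0 (col j X)) _.
by rewrite tr_col -row_mul [col j X]colE mulmxA -row_mul -colE !mxE.
Qed.

End Norms.

(** * The Laplacian and its spectral gap *)

Lemma quadratic_form_expand (R : realType) n (M : 'M[R]_n) (u w : 'rV[R]_n) t :
  M^T = M ->
  ((u + t *: w) *m M *m (u + t *: w)^T) 0 0 =
  (u *m M *m u^T) 0 0 + 2 * t * (u *m M *m w^T) 0 0
  + t ^+ 2 * (w *m M *m w^T) 0 0.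
Proof.
move=> MT.
have symE : (w *m M *m u^T) 0 0 = (u *m M *m w^T) 0 0.
  have tr11 (X : 'M[R]_1) : X^T 0 0 = X 0 0 by rewrite mxE.
  by rewrite -[LHS]tr11 trmx_mul trmxK trmx_mul MT mulmxA.
rewrite linearD/= linearZ/= !mulmxDl !mulmxDr.
rewrite -!scalemxAl -!scalemxAr.
have mxD (X Y : 'M[R]_1) : (X + Y) 0 0 = X 0 0 + Y 0 0 by rewrite mxE.
have mxZ c (X : 'M[R]_1) : (c *: X) 0 0 = c * X 0 0 by rewrite mxE.
by rewrite !mxD !mxZ symE; ring.
Qed.

Section GaugedLaplacian.
Context {R : realType} {N : nat}.
Variables (W : 'M[R]_N) (sigma : 'I_N -> R).
Hypotheses (W_weights : signed_weights W) (sigma_gauge : gauge W sigma).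
Let L := gauged_laplacian W sigma.

Lemma gauge_sqr i : sigma i * sigma i = 1.
Proof. by case: (sigma_gauge.1 i) => ->; rewrite ?mulrNN mulr1. Qed.

Lemma gauge_norm i : `|sigma i| = 1.
Proof. by case: (sigma_gauge.1 i) => ->; rewrite ?normrN normr1. Qed.

Lemma gauge_mxE (M : 'M[R]_N) i j :
  (gauge_mx sigma *m M *m gauge_mx sigma) i j = sigma i * M i j * sigma j.
Proof. by rewrite mul_mx_diag mxE mul_diag_mx !mxE. Qed.

(** A gauge transformation by signs that makes all weights nonnegative replaces each
    weight by its absolute value. *)
Lemma gauge_abs i j : sigma i * W i j * sigma j = `|W i j|.
Proof.
have := sigma_gauge.2 i j; rewrite gauge_mxE => /ger0_norm <-.
by rewrite !normrM !gauge_norm mul1r mulr1.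
Qed.

Lemma weights_sym i j : W i j = W j i.
Proof. by rewrite -[in LHS]W_weights.1 mxE. Qed.

Lemma gauged_laplacianE i j :
  L i j = (\sum_k `|W i k|) *+ (i == j) - `|W i j|.
Proof.
rewrite /L /gauged_laplacian gauge_mxE !mxE mulrBr mulrBl gauge_abs.
congr (_ - _); case: eqP => [->|_]; last by rewrite !mulr0n mulr0 mul0r.
by rewrite !mulr1n mulrAC gauge_sqr mul1r.
Qed.

Lemma gauged_laplacian_sym : L^T = L.
Proof.
apply/matrixP => i j; rewrite mxE !gauged_laplacianE weights_sym; congr (_ - _).
by case: eqVneq => [->|].
Qed.

(** The gauged Laplacian is the diffusion operator of the graph with the nonnegative
    weights |W i j|. *)
Lemma sum_gauged_laplacian i (f : 'I_N -> R) :
  \sum_j L i j * f j = \sum_j `|W i j| * (f i - f j).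
Proof.
under eq_bigr do rewrite gauged_laplacianE mulrBl.
rewrite sumrB; under [RHS]eq_bigr do rewrite mulrBr.
rewrite sumrB; congr (_ - _); rewrite (bigD1 i)//= eqxx mulr1n [X in _ + X]big1 => [|j ji].
  by rewrite addr0 mulr_suml.
by rewrite eq_sym (negPf ji) mul0r.
Qed.

Lemma gauged_laplacian_const : L *m const_mx 1 = 0 :> 'cV_N.
Proof.
apply/matrixP => i k; rewrite !mxE.
under eq_bigr do rewrite [const_mx _ _ _]mxE.
by rewrite (sum_gauged_laplacian i (fun=> 1)) big1// => j _; rewrite subrr mulr0.
Qed.

Definition qform (v : 'rV[R]_N) : R := \sum_i \sum_j v 0 i * L i j * v 0 j.

Lemma qformE v : qform v = (v *m L *m v^T) 0 0.
Proof.
rewrite /qform exchange_big/= mxE; apply: eq_bigr => j _.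
by rewrite !mxE mulr_suml; apply: eq_bigr.
Qed.

Lemma qform_squares v :
  qform v = 2^-1 * \sum_i \sum_j `|W i j| * (v 0 i - v 0 j) ^+ 2.
Proof.
have E1 : qform v = \sum_i \sum_j `|W i j| * (v 0 i * (v 0 i - v 0 j)).
  apply: eq_bigr => i _; under eq_bigr do rewrite -mulrA.
  rewrite -mulr_sumr sum_gauged_laplacian mulr_sumr.
  by apply: eq_bigr => j _; rewrite mulrCA.
have E2 : qform v = \sum_i \sum_j `|W i j| * (v 0 j * (v 0 j - v 0 i)).
  rewrite E1 exchange_big/=; apply: eq_bigr => i _; apply: eq_bigr => j _.
  by rewrite weights_sym.
suff E : qform v + qform v =
    \sum_i \sum_j `|W i j| * (v 0 i - v 0 j) ^+ 2 by rewrite -E; field.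
rewrite {1}E1 E2 -big_split; apply: eq_bigr => i _.
by rewrite -big_split; apply: eq_bigr => j _ /=; ring.
Qed.

Lemma qform_ge0 v : 0 <= qform v.
Proof.
rewrite qform_squares mulr_ge0//; apply: sumr_ge0 => i _; apply: sumr_ge0 => j _.
by rewrite mulr_ge0 ?sqr_ge0.
Qed.

(** A vector without energy takes the same value at both ends of every edge, so it
    is constant on a connected graph. *)
Lemma qform_eq0 (v : 'rV[R]_N) : signed_connected W -> qform v = 0 ->
  forall i j, v 0 i = v 0 j.
Proof.
move=> W_conn; rewrite qform_squares => /eqP; rewrite mulf_eq0 invr_eq0 pnatr_eq0/=.
have W0 i j : 0 <= `|W i j| * (v 0 i - v 0 j) ^+ 2 by rewrite mulr_ge0 ?sqr_ge0.
move=> /eqP/psumr_eq0P v0 i j.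
have edge a b : W b a != 0 -> v 0 a = v 0 b.
  move=> Wba; have := v0 (fun i _ => sumr_ge0 _ (fun j _ => W0 i j)) b isT.
  move=> /psumr_eq0P => /(_ (fun j _ => W0 b j)) /(_ a isT) /eqP.
  by rewrite mulf_eq0 normr_eq0 (negPf Wba)/= sqrf_eq0 subr_eq0 => /eqP.
have /connectP[s + ->] := W_conn i j.
elim: s i => //= k s ih i /andP[/edge -> ?]; exact: ih.
Qed.

(** The gauge matrix is its own inverse, so the two Laplacians are similar. *)
Lemma eigenvalue_gauged a : eigenvalue L a -> eigenvalue (laplacian W) a.
Proof.
have DD : gauge_mx sigma *m gauge_mx sigma = 1%:M.
  by apply/matrixP => i j; rewrite mul_diag_mx !mxE mulrnAr gauge_sqr.
case/eigenvalueP => v vL v0; apply/eigenvalueP; exists (v *m gauge_mx sigma).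
  rewrite scalemxAl -vL /L /gauged_laplacian !mulmxA -mulmxA.
  by rewrite -[RHS]mulmxA DD mulmx1.
apply: contra v0 => /eqP vD; apply/eqP.
by rewrite -[v]mulmx1 -DD mulmxA vD mul0mx.
Qed.

Let lambda := min_pos_eigenvalue (laplacian W).

(** Without any positive eigenvalue, this is the infimum of the empty set, 0. *)
Lemma min_pos_eigenvalue_ge0 : 0 <= lambda.
Proof.
rewrite /lambda /min_pos_eigenvalue; set S := [set _ | _].
have [->|/set0P S0] := eqVneq S set0; first by rewrite inf0.
by apply: lb_le_inf => // a [/ltW].
Qed.

Lemma min_pos_eigenvalue_le a : 0 < a -> eigenvalue (laplacian W) a ->
  lambda <= a.
Proof.
move=> a0 ea; apply: ge_inf; last by split.
by exists 0 => b [/ltW].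
Qed.

Lemma continuous_bigsum (T : topologicalType) n (f : 'I_n -> T -> R) :
  (forall i, continuous (f i)) -> continuous (fun x => \sum_i f i x).
Proof.
move=> cf x; rewrite (_ : (fun _ => _) = \sum_i f i); last first.
  by apply/funext => k; rewrite fct_sumE.
elim/big_ind : _ => //; first exact: cst_continuous.
by move=> g k cg ck; exact: cvgD.
Qed.

Lemma qform_continuous : continuous qform.
Proof.
apply: continuous_bigsum => i; apply: continuous_bigsum => j v.
apply: (@continuousM _ _ (fun u : 'rV[R]_N => u 0 i * L i j)
  (fun u : 'rV[R]_N => u 0 j)); last exact: coord_continuous.
apply: (@continuousM _ _ (fun u : 'rV[R]_N => u 0 i) (fun=> L i j)).
  exact: coord_continuous.
exact: cst_continuous.
Qed.

Definition sqnormr (v : 'rV[R]_N) : R := \sum_i v 0 i ^+ 2.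

Lemma sqnormrE v : sqnormr v = (v *m v^T) 0 0.
Proof. by rewrite mxE; apply: eq_bigr => i _; rewrite mxE expr2. Qed.

Lemma sqnormr_eq0 v : sqnormr v = 0 -> v = 0.
Proof.
move=> /psumr_eq0P v0; apply/rowP => i; rewrite mxE.
by apply/eqP; rewrite -sqrf_eq0 v0// => k _; exact: sqr_ge0.
Qed.

(** On the unit sphere of the sum-zero hyperplane, which is compact, the energy
    attains its minimum; by homogeneity the inequality extends to the hyperplane. *)
Lemma rayleigh_min : (exists2 v : 'rV[R]_N, \sum_i v 0 i = 0 & v != 0) ->
  exists v0 : 'rV[R]_N, [/\ \sum_i v0 0 i = 0, sqnormr v0 = 1 &
    forall v : 'rV[R]_N, \sum_i v 0 i = 0 -> qform v0 * sqnormr v <= qform v].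
Proof.
have qZ c v : qform (c *: v) = c ^+ 2 * qform v.
  by rewrite !qformE linearZ/= -!scalemxAl -scalemxAr !mxE mulrA expr2.
have sZ c v : sqnormr (c *: v) = c ^+ 2 * sqnormr v.
  by rewrite /sqnormr mulr_sumr; apply: eq_bigr => i _; rewrite mxE exprMn.
have sumZ c (v : 'rV[R]_N) : \sum_i v 0 i = 0 -> \sum_i (c *: v) 0 i = 0.
  by move=> v0; under eq_bigr do rewrite mxE; rewrite -mulr_sumr v0 mulr0.
have sgt0 v : v != 0 -> 0 < sqnormr v.
  move=> v0; rewrite lt0r sumr_ge0 ?andbT; last by move=> *; exact: sqr_ge0.
  by apply: contra v0 => /eqP/sqnormr_eq0 ->.
have normalize v : v != 0 -> sqnormr ((Num.sqrt (sqnormr v))^-1 *: v) = 1.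
  by move=> /sgt0 sv; rewrite sZ exprVn sqr_sqrtr ?ltW// mulVf// gt_eqF.
case=> w w0 wn0.
pose S := [set v : 'rV[R]_N | \sum_i v 0 i = 0 /\ sqnormr v = 1].
have S0 : S !=set0.
  by exists ((Num.sqrt (sqnormr w))^-1 *: w); split; [exact: sumZ|exact: normalize].
have cS : compact S.
  apply: bounded_closed_compact.
    exists 1; split; first exact: num_real.
    move=> M M1 v [_ v1]; rewrite /Num.Def.normr/= mx_normrE.
    apply: bigmax_le; first by rewrite ltW// (lt_trans _ M1).
    move=> [i j] _ /=; rewrite ord1 (le_trans _ (ltW M1))//.
    rewrite -(@ler_pXn2r _ 2)// ?nnegrE// expr1n real_normK ?num_real// -v1.
    by rewrite /sqnormr (bigD1 j)//= lerDl sumr_ge0// => *; exact: sqr_ge0.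
  rewrite (_ : S = ((fun v : 'rV[R]_N => \sum_i v 0 i) @^-1` [set 0]) `&`
                   (sqnormr @^-1` [set 1])); last by apply/seteqP; split.
  have c1 : continuous (fun v : 'rV[R]_N => \sum_i v 0 i).
    by apply: continuous_bigsum => i; exact: coord_continuous.
  have c2 : continuous sqnormr.
    rewrite (_ : sqnormr = fun v => \sum_i v 0 i * v 0 i); last first.
      by apply/funext => v; apply: eq_bigr => i _; rewrite expr2.
    apply: continuous_bigsum => i u.
    by apply: (@continuousM _ _ (fun u : 'rV[R]_N => u 0 i)); exact: coord_continuous.
  by apply: closedI; apply: preimage_closed; try exact: closed_eq.
have [v0 /set_mem[v00 v01] v0min] := EVT_min_rV S0 cS
  (continuous_subspaceT qform_continuous).
exists v0; split => // v v_0.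
have [->|vn0] := eqVneq v 0.
  rewrite (_ : sqnormr 0 = 0) ?mulr0 ?qform_ge0//.
  by rewrite /sqnormr big1// => i _; rewrite mxE expr0n.
have := v0min ((Num.sqrt (sqnormr v))^-1 *: v).
rewrite inE => /(_ (conj (sumZ _ _ v_0) (normalize _ vn0))).
rewrite qZ exprVn sqr_sqrtr; last exact: ltW (sgt0 _ vn0).
by rewrite ler_pdivlMl ?sgt0// mulrC.
Qed.

(** The minimum mu of the Rayleigh quotient over the sum-zero vectors is a positive
    eigenvalue of L, hence at least the smallest one. It is positive because a
    vector without energy is constant, and it is an eigenvalue because the residual
    w = v0 L - mu v0 at a minimizer v0 is again sum-zero: unless w = 0, moving from
    v0 in the direction - w would decrease the quotient. *)
Lemma spectral_gap (v : 'rV[R]_N) : signed_connected W -> \sum_i v 0 i = 0 ->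
  lambda * sqnormr v <= qform v.
Proof.
move=> W_conn v_0.
have [->|vn0] := eqVneq v 0.
  rewrite (_ : sqnormr 0 = 0) ?mulr0 ?qform_ge0//.
  by rewrite /sqnormr big1// => i _; rewrite mxE expr0n.
have [v0 [v00 v01 v0min]] := rayleigh_min (ex_intro2 _ _ v v_0 vn0).
apply: le_trans (v0min _ v_0); rewrite ler_wpM2r//.
  by apply: sumr_ge0 => i _; exact: sqr_ge0.
set mu := qform v0.
have mu0 : 0 < mu.
  rewrite lt0r qform_ge0 andbT; apply/eqP => /(qform_eq0 W_conn) v0c.
  have v0i i : v0 0 i = 0.
    apply/eqP; have : N%:R * v0 0 i = 0.
      rewrite -v00 (eq_bigr (fun=> v0 0 i)) => [|j _]; last exact: v0c.
      by rewrite sumr_const card_ord mulr_natl.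
    move/eqP; rewrite mulf_eq0 pnatr_eq0 gtn_eqF//.
    exact: leq_ltn_trans (ltn_ord i).
  move/eqP: v01; rewrite /sqnormr big1 => [|i _]; last by rewrite v0i expr0n.
  by rewrite eq_sym oner_eq0.
apply: min_pos_eigenvalue_le => //; apply/eigenvalue_gauged/eigenvalueP.
exists v0; last first.
  apply/eqP => v0z; move/eqP: v01; rewrite v0z /sqnormr big1 => [|i _].
    by rewrite eq_sym oner_eq0.
  by rewrite mxE expr0n.
apply/eqP; rewrite -subr_eq0; apply/eqP; set w := (X in X = 0).
have sumE (u : 'rV[R]_N) : \sum_i u 0 i = (u *m (const_mx 1 : 'cV[R]_N)) 0 0.
  by rewrite mxE; apply: eq_bigr => i _; rewrite mxE mulr1.
have w0 : \sum_i w 0 i = 0.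
  rewrite sumE /w mulmxBl -mulmxA gauged_laplacian_const mulmx0 sub0r.
  by rewrite -scalemxAl mxE mxE -sumE v00 mulr0 oppr0.
(* The first variation at the minimizer, in the direction of the residual w, is
   the squared norm of w. *)
have q_exp t : qform (v0 + t *: w) - mu * sqnormr (v0 + t *: w) =
    2 * t * sqnormr w + t ^+ 2 * (qform w - mu * sqnormr w).
  have crossE : (v0 *m L *m w^T) 0 0 - mu * (v0 *m w^T) 0 0 = sqnormr w.
    by rewrite sqnormrE {3}/w mulmxBl -scalemxAl !mxE.
  have sE u : sqnormr u = (u *m 1%:M *m u^T) 0 0 by rewrite mulmx1 -sqnormrE.
  rewrite -[in 2 * t * _]crossE !qformE !sE quadratic_form_expand ?gauged_laplacian_sym//.
  rewrite quadratic_form_expand ?trmx1// -sE -qformE -/mu -!sE mulmx1.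
  rewrite v01; ring.
apply: sqnormr_eq0; apply/eqP; rewrite eq_le sumr_ge0 ?andbT; last first.
  by move=> i _; exact: sqr_ge0.
rewrite leNgt; apply/negP => sw.
set q := qform w - mu * sqnormr w in q_exp.
have q0 : 0 <= q by rewrite subr_ge0; exact: v0min.
(* A step short enough for the linear term to dominate the quadratic one. *)
have := q_exp (- (sqnormr w / (q + 1))).
have : 0 <= qform (v0 + - (sqnormr w / (q + 1)) *: w) -
            mu * sqnormr (v0 + - (sqnormr w / (q + 1)) *: w).
  rewrite subr_ge0; apply: v0min.
  under eq_bigr do rewrite mxE [X in _ + X]mxE.
  by rewrite big_split/= v00 -mulr_sumr w0 mulr0 addr0.
move=> /[swap] ->.
rewrite (_ : _ + _ = - (sqnormr w / (q + 1)) ^+ 2 * (q + 2)); last first.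
  by field; rewrite gt_eqF// ltr_wpDl.
rewrite mulNr oppr_ge0 leNgt mulr_gt0 ?exprn_gt0 ?divr_gt0//.
  by rewrite ltr_wpDl.
by rewrite ltr_wpDl.
Qed.

(** The spectral gap, applied to each row. *)
Lemma spectral_gap_trace p (Y : 'M[R]_(p, N)) : signed_connected W ->
  Y *m const_mx 1 = 0 :> 'cV_p -> lambda * fnorm2 Y <= \tr (Y *m L *m Y^T).
Proof.
move=> W_conn Y0; rewrite -fnorm2_tr mulr_sumr; apply: ler_sum => r _.
have sumY : \sum_i row r Y 0 i = 0.
  transitivity ((Y *m (const_mx 1 : 'cV_N)) r 0); last by rewrite Y0 mxE.
  by rewrite mxE; apply: eq_bigr => i _; rewrite !mxE mulr1.
have := spectral_gap W_conn sumY.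
rewrite (_ : sqnormr _ = cnorm2 Y^T r); last by apply: eq_bigr => i _; rewrite !mxE.
rewrite qformE tr_row -!row_mul [col r _]colE mulmxA -colE.
by rewrite [X in _ <= X]mxE [X in _ <= X]mxE.
Qed.

End GaugedLaplacian.

(** * Decay of the disagreement *)

Section Lyapunov.
Context {R : realType} {N n m : nat}.
Variables (A : 'M[R]_n) (B : 'M[R]_(n, m)) (P Q : 'M[R]_n) (L : 'M[R]_N).
Variables (kappa c lambda : R).
Hypotheses (P_posdef : posdefmx P) (L_sym : L^T = L).
Hypothesis QE : Q = P *m B *m B^T *m P.
Hypothesis lambda_ge0 : 0 <= lambda.
Hypothesis gap : forall Y : 'M[R]_(m, N), Y *m const_mx 1 = 0 :> 'cV_m ->
  lambda * fnorm2 Y <= \tr (Y *m L *m Y^T).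
Hypothesis P_lmi : loewner_lt (A^T *m P + P *m A - lambda *: Q) (- kappa%:M).
Hypothesis c_gt0 : 0 < c.

Lemma posdefmx_ge0 p (M : 'M[R]_p) (v : 'cV[R]_p) : posdefmx M ->
  0 <= (v^T *m M *m v) 0 0.
Proof.
move=> [_ M0]; have [->|/M0/ltW//] := eqVneq v 0.
by rewrite mulmx0 mxE.
Qed.

Let Q_sym : Q^T = Q.
Proof. by rewrite QE !trmx_mul trmxK P_posdef.1 !mulmxA. Qed.

(** The left-hand side is the derivative of trace (D^T P D) along D' = dD. The matrix
    inequality provides - kappa |D|^2 at the cost of lambda trace (D^T Q D), which
    the spectral gap pays for: the diffusion term - 2 trace (D^T Q D L) is at most
    - 2 lambda trace (D^T Q D). The remaining cross term with E is split by Young's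
    inequality with weight c. *)
Lemma lyapunov_derivative_le (D E dD : 'M[R]_(n, N)) :
  D *m const_mx 1 = 0 :> 'cV_n ->
  dD = A *m D - B *m (B^T *m P) *m (D + E) *m L ->
  \tr (dD^T *m P *m D + D^T *m P *m dD) <=
  - (kappa - c * opnorm (L *t Q) ^+ 2) * fnorm2 D + fnorm2 E / c.
Proof.
move=> D0 dDE.
have gapD : lambda * \tr (D^T *m Q *m D) <= \tr (D^T *m Q *m D *m L).
  have FD0 : (B^T *m P *m D) *m const_mx 1 = 0 :> 'cV_m.
    by rewrite -mulmxA D0 mulmx0.
  have := gap FD0; rewrite fnorm2_trace -[\tr (_ *m L *m _)]mxtrace_mulC.
  by rewrite !trmx_mul trmxK P_posdef.1 QE !mulmxA.
have Q0 : 0 <= \tr (D^T *m Q *m D).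
  rewrite (_ : D^T *m Q *m D = (B^T *m P *m D)^T *m (B^T *m P *m D)).
    by rewrite -fnorm2_trace fnorm2_ge0.
  by rewrite !trmx_mul trmxK P_posdef.1 QE !mulmxA.
have lmi : \tr (D^T *m (A^T *m P + P *m A) *m D) <=
    lambda * \tr (D^T *m Q *m D) - kappa * fnorm2 D.
  have := trace_form_ge0 D (fun v => posdefmx_ge0 v P_lmi).
  rewrite !mulmxBr !mulmxBl !linearB/= mulmxN mulNmx linearN/=.
  rewrite mul_mx_scalar -!scalemxAl -scalemxAr -scalemxAl !linearZ/=.
  by rewrite -fnorm2_trace !scalerN opprK -![_ *: _]/(_ * _); lra.
have young : - 2 * \tr (D^T *m Q *m E *m L) <=
    c * (opnorm (L *t Q) ^+ 2 * fnorm2 D) + fnorm2 E / c.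
  have := young_trace (Q *m D *m L) E c_gt0.
  rewrite trmx_mul L_sym trmx_mul Q_sym -!mulmxA mxtrace_mulC !mulmxA.
  move=> /le_trans; apply; rewrite lerD2r ler_wpM2l ?(ltW c_gt0)//.
  by have := fnorm2_kron L Q D; rewrite L_sym.
have {}dDE : D^T *m P *m dD =
    D^T *m P *m A *m D - D^T *m Q *m D *m L - D^T *m Q *m E *m L.
  rewrite dDE mulmxBr !mulmxA mulmxDr mulmxDl opprD addrA.
  by rewrite QE !mulmxA.
have tr_sym : \tr (dD^T *m P *m D) = \tr (D^T *m P *m dD).
  by rewrite -mxtrace_tr !trmx_mul trmxK P_posdef.1 mulmxA.
have symA : \tr (D^T *m (A^T *m P + P *m A) *m D) = 2 * \tr (D^T *m P *m A *m D).
  rewrite mulmxDr mulmxDl linearD/= mulr2n mulrDl mul1r; congr (_ + _).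
    by rewrite -mxtrace_tr !trmx_mul !trmxK P_posdef.1 !mulmxA.
  by rewrite !mulmxA.
rewrite linearD/= tr_sym dDE !linearB/=.
move: gapD lmi young; rewrite symA => {}gapD lmi young.
have := mulr_ge0 lambda_ge0 Q0; lra.
Qed.

End Lyapunov.

(** * Regularity of matrix-valued functions, entry by entry *)

Section FunctionAlgebra.
Context {R : realType}.

(** Bounded measurability, continuity at a point and continuity on a set all pass
    from the entries of matrices to the entries of their sums and products, for the
    same reason: each is a class of functions closed under the ring operations. *)
Definition fun_alg (C : (R -> R) -> Prop) := [/\ forall c, C (fun=> c),
  forall f g, C f -> C g -> C (fun t => f t + g t) &
  forall f g, C f -> C g -> C (fun t => f t * g t)].

Lemma fun_alg_bmeas a b : fun_alg (bmeas a b).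
Proof.
by split; [exact: bmeas_cst|move=> *; exact: bmeasD|move=> *; exact: bmeasM].
Qed.

Lemma fun_alg_cont (t : R) : fun_alg (fun f => {for t, continuous f}).
Proof.
split=> [c|f g cf cg|f g cf cg]; first exact: cst_continuous.
- exact: (@continuousD _ _ _ f g).
- exact: (@continuousM _ _ f g).
Qed.

Lemma fun_alg_within (D : set R) :
  fun_alg (fun f => {within D, continuous f}).
Proof.
split=> [c|f g cf cg|f g cf cg] t.
- exact: cst_continuous.
- exact: (continuousD (cf t) (cg t)).
- exact: (continuousM (cf t) (cg t)).
Qed.

Variables (C : (R -> R) -> Prop) (C_alg : fun_alg C).

Definition entrywise p q (M : R -> 'M[R]_(p, q)) :=
  forall i j, C (fun t => M t i j).

Lemma fun_alg_ext f g : f =1 g -> C f -> C g.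
Proof. by move=> /funext ->. Qed.

Lemma fun_alg_sum (I : Type) (r : seq I) (f : I -> R -> R) :
  (forall i, C (f i)) -> C (fun t => \sum_(i <- r) f i t).
Proof.
case: C_alg => Cc CD _ Cf; elim: r => [|i r ih].
  by apply: fun_alg_ext (Cc 0) => t; rewrite big_nil.
by apply: fun_alg_ext (CD _ _ (Cf i) ih) => t; rewrite big_cons.
Qed.

Lemma entrywise_cst p q (M : 'M[R]_(p, q)) : entrywise (fun=> M).
Proof. by case: C_alg => Cc _ _ i j; exact: Cc. Qed.

Lemma entrywiseD p q (M M' : R -> 'M[R]_(p, q)) :
  entrywise M -> entrywise M' -> entrywise (fun t => M t + M' t).
Proof.
case: C_alg => _ CD _ CM CM' i j.
by apply: fun_alg_ext (CD _ _ (CM i j) (CM' i j)) => t; rewrite mxE.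
Qed.

Lemma entrywiseM p q r (M : R -> 'M[R]_(p, q)) (M' : R -> 'M[R]_(q, r)) :
  entrywise M -> entrywise M' -> entrywise (fun t => M t *m M' t).
Proof.
case: C_alg => _ _ CM hM hM' i j.
apply: (@fun_alg_ext (fun t => \sum_k M t i k * M' t k j)).
  by move=> t; rewrite mxE.
by apply: fun_alg_sum => k; exact: CM.
Qed.

Lemma entrywise_tr p q (M : R -> 'M[R]_(p, q)) :
  entrywise M -> entrywise (fun t => (M t)^T).
Proof. by move=> hM i j; apply: fun_alg_ext (hM j i) => t; rewrite mxE. Qed.

Lemma entrywiseB p q (M M' : R -> 'M[R]_(p, q)) :
  entrywise M -> entrywise M' -> entrywise (fun t => M t - M' t).
Proof.
move=> hM hM'.
have := entrywiseD hM (entrywiseM (entrywise_cst (- 1%:M)) hM').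
move=> H i j; apply: fun_alg_ext (H i j) => t.
by rewrite mulNmx mul1mx.
Qed.

Lemma entrywise_trace p (M : R -> 'M[R]_p) : entrywise M -> C (fun t => \tr (M t)).
Proof. by move=> hM; apply: fun_alg_sum => i; exact: hM. Qed.

Lemma entrywise_cnorm2 p q (M : R -> 'M[R]_(p, q)) j :
  entrywise M -> C (fun t => cnorm2 (M t) j).
Proof.
move=> hM; have := entrywiseM (entrywise_tr hM) hM.
by move=> /(_ j j); apply: fun_alg_ext => t; rewrite cnorm2_tr.
Qed.

Lemma entrywise_fnorm2 p q (M : R -> 'M[R]_(p, q)) :
  entrywise M -> C (fun t => fnorm2 (M t)).
Proof. by move=> hM; apply: fun_alg_sum => j; exact: entrywise_cnorm2. Qed.

End FunctionAlgebra.

(** * Triggering instants of one agent *)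

Section Instants.
Context {R : realType} {N n m : nat}.
Variables (ti : nat -> \bar R).
Hypotheses (ti0 : ti 0%N = 0%E) (ti_le : forall k, (ti k <= ti k.+1)%E).

Lemma instant_homo k l : (k <= l)%N -> (ti k <= ti l)%E.
Proof.
by move=> /subnK <-; elim: (l - k)%N => [|d ih] //; apply: le_trans ih (ti_le _).
Qed.

Lemma instant_ge0 k : (0 <= ti k)%E.
Proof. by rewrite -ti0 instant_homo. Qed.

Lemma is_latest_le t k l : is_latest ti t k -> (ti l <= t%:E)%E -> (l <= k)%N.
Proof.
move=> [_ tk] lt_; rewrite leqNgt; apply/negP => /instant_homo kl.
by have := lt_le_trans tk (le_trans kl lt_); rewrite ltxx.
Qed.

Lemma latestE t k : is_latest ti t k -> latest ti t = k.
Proof.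
move=> tk; apply/eqP; rewrite eqn_leq.
have tl : is_latest ti t (latest ti t) by apply: (xgetPex 0%N); exists k.
by rewrite (is_latest_le tk tl.1) (is_latest_le tl tk.1).
Qed.

Lemma latestP t : (exists k, is_latest ti t k) -> is_latest ti t (latest ti t).
Proof. by case=> k tk; rewrite (latestE tk). Qed.

Lemma instant_fin t k : (ti k <= t%:E)%E -> ti k = (fine (ti k))%:E.
Proof.
by move=> tk; rewrite fineK// ge0_fin_numE ?instant_ge0// (le_lt_trans tk)// ltry.
Qed.

Lemma instant_fine_ge0 k : 0 <= fine (ti k).
Proof. by rewrite fine_ge0// instant_ge0. Qed.

(** A latest instant at time t bounds the indices of the instants up to s, so there
    is a largest one. *)
Lemma has_latest_le s t : 0 <= s <= t -> (exists k, is_latest ti t k) ->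
  exists k, is_latest ti s k.
Proof.
move=> /andP[s0 st] [k tk].
have ex0 : exists l, (ti l <= s%:E)%E by exists 0%N; rewrite ti0 lee_fin.
have bound l : (ti l <= s%:E)%E -> (l <= k)%N.
  by move=> ls; apply: (is_latest_le tk); rewrite (le_trans ls)// lee_fin.
have [l ls lmax] := ex_maxnP ex0 bound.
by exists l; split => //; rewrite ltNge; apply/negP => /lmax; rewrite ltnn.
Qed.

(** If t is not an instant, then both inequalities that define the latest instant
    are strict, hence stable under small perturbations of t. *)
Lemma is_latest_near t k : is_latest ti t k -> (forall l, ti l <> t%:E) ->
  \forall s \near t, is_latest ti s k.
Proof.
move=> [kt tk] tnt.
have rt : fine (ti k) < t.
  rewrite -lte_fin -(instant_fin kt) lt_neqAle kt andbT; exact/eqP.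
have near_lt : \forall s \near t, (s%:E < ti k.+1)%E.
  case: (ti k.+1) tk => [r|_|//]; last by near=> s; exact: ltry.
  by rewrite lte_fin => /lt_nbhsl; apply: filterS => s; rewrite lte_fin.
near=> s; split; last by near: s.
by rewrite (instant_fin kt) lee_fin ltW//; near: s; exact: lt_nbhsr.
Unshelve. all: by end_near. Qed.

Lemma measurable_is_latest k :
  measurable ([set t | is_latest ti t k] : set (measurableTypeR R)).
Proof.
rewrite (_ : [set _ | _] = setT `&` (EFin @^-1` [set` `[ti k, ti k.+1[])).
  by apply: EFin_measurable => //; exact: emeasurable_itv.
apply/seteqP; split=> t /=; rewrite in_itv/=; first by move=> [-> ->].
by move=> [_ /andP[]].
Qed.

End Instants.

(** * States and sampled signals as matrices *)

Section Signals.
Context {R : realType} {N n m : nat}.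
Variables (A : 'M[R]_n) (B : 'M[R]_(n, m)) (K : 'M[R]_(m, n)) (W : 'M[R]_N).
Variables (sigma beta : 'I_N -> R) (h : R -> R).
Variables (x : 'I_N -> R -> 'cV[R]_n) (tau : 'I_N -> nat -> \bar R).
Hypotheses (W_weights : signed_weights W) (sigma_gauge : gauge W sigma).
Hypothesis x_sol : closed_loop A B K W x tau.
Let L := gauged_laplacian W sigma.

Let tau0 i : tau i 0%N = 0%E. Proof. by case: x_sol. Qed.
Let tau_le i k : (tau i k <= tau i k.+1)%E. Proof. by case: x_sol. Qed.

Lemma signal_domain_le s t : 0 <= s <= t -> signal_domain tau t ->
  signal_domain tau s.
Proof.
move=> st [t0 tl]; split; first by case/andP: st.
by move=> i; apply: (has_latest_le (tau0 i) (tau_le i) st).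
Qed.

(** Up to time t, the instants of an agent have indices bounded by that of its latest
    instant at t, so there are finitely many of them. *)
Lemma event_times t : signal_domain tau t ->
  exists S : seq R, forall s, s <= t -> s \notin S ->
    forall j l, tau j l <> s%:E.
Proof.
move=> [t0 tl].
exists [seq fine (tau j l) | j <- enum 'I_N, l <- iota 0 (latest (tau j) t).+1].
move=> s st + j l tjl => /negP; apply; apply/allpairsPdep.
exists j, l; split; [by rewrite mem_enum| |by rewrite tjl].
rewrite mem_iota/= add0n ltnS.
apply: (is_latest_le (tau_le j) (latestP (tau_le j) (tl j))).
by rewrite tjl lee_fin.
Qed.

(** The sampled signal that agent i would hold at all times with the data of its
    k-th instant: a smooth function, with which xhat agrees as long as k is the
    latest instant. *)
Definition sampled_piece i k (t : R) : 'cV[R]_n :=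
  expmx ((t - fine (tau i k)) *: A) *m x i (fine (tau i k)).

Lemma xhat_sampled_piece i k t : is_latest (tau i) t k ->
  xhat A x tau i t = sampled_piece i k t.
Proof. by move=> tk; rewrite /xhat (latestE (tau_le i) tk). Qed.

Lemma is_derive_sampled_piece i k (t : R) :
  is_derive t 1 (sampled_piece i k) (A *m sampled_piece i k t).
Proof.
rewrite /sampled_piece mulmxA; apply: is_derive_mulmxr; apply/is_derive_mxP => a b.
have /is_derive_mxP/(_ a b) dE := is_derive_expmx A (t - fine (tau i k)).
have dS : is_derive t 1 (fun s : R => s - fine (tau i k)) 1.
  by rewrite -[X in is_derive _ _ _ X]subr0; exact: is_deriveB.
have := @is_derive1_comp _ (fun s => expmx (s *: A) a b)
  (fun s => s - fine (tau i k)) t _ _ dE dS.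
by rewrite mulr1.
Qed.

Lemma is_derive_continuous p q (M : R -> 'M[R]_(p, q)) (t : R) dM :
  is_derive t 1 M dM -> entrywise (fun f => {for t, continuous f}) M.
Proof.
move=> /is_derive_mxP dMt i j; have [dMij _] := dMt i j.
exact/differentiable_continuous/derivable1_diffP.
Qed.

Lemma sampled_piece_within i k (D : set R) :
  entrywise (fun f => {within D, continuous f}) (sampled_piece i k).
Proof.
move=> a b; apply: continuous_subspaceT => t.
exact: (is_derive_continuous (is_derive_sampled_piece i k t)).
Qed.

Definition state_mx t : 'M[R]_(n, N) := \matrix_(a, i) zstate sigma x i t a 0.
Definition sampled_mx t : 'M[R]_(n, N) := \matrix_(a, i) zhat A sigma x tau i t a 0.
Definition error_mx t : 'M[R]_(n, N) := sampled_mx t - state_mx t.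

Lemma zerror_cnorm2 i t :
  enorm (zerror A sigma x tau i t) ^+ 2 = cnorm2 (error_mx t) i.
Proof. by rewrite enorm_sqr; apply: eq_bigr => a _; rewrite !mxE. Qed.

(** The disagreement of the sampled signals that enters the triggering rule is a
    column of their product with the gauged Laplacian, L being symmetric. *)
Lemma diffusion_col i t :
  \sum_j `|W i j| *: (zhat A sigma x tau i t - zhat A sigma x tau j t) =
  col i (sampled_mx t *m L).
Proof.
apply/colP => a; rewrite summxE !mxE.
have := sum_gauged_laplacian sigma_gauge i (fun j => sampled_mx t a j).
rewrite -/L => E; transitivity (\sum_j L i j * sampled_mx t a j).
  by rewrite E; apply: eq_bigr => j _; rewrite !mxE.
apply: eq_bigr => j _; rewrite mulrC; congr (_ * _).
have /matrixP/(_ j i) := gauged_laplacian_sym W_weights sigma_gauge.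
by rewrite mxE.
Qed.

Lemma gfunE i t : gfun A W sigma beta h x tau i t =
  cnorm2 (error_mx t) i - beta i * cnorm2 (sampled_mx t *m L) i - beta i * h t.
Proof.
by rewrite /gfun zerror_cnorm2 diffusion_col enorm_sqr cnorm2_col.
Qed.

Lemma weight_gauge i j : sigma i * W i j = `|W i j| * sigma j.
Proof. by rewrite -(gauge_abs sigma_gauge) -[RHS]mulrA (gauge_sqr sigma_gauge) mulr1. Qed.

(** In the gauged coordinates the signed coupling becomes ordinary diffusion. *)
Lemma control_col i t :
  sigma i *: control A K W x tau i t = - (K *m col i (sampled_mx t *m L)).
Proof.
rewrite /control -diffusion_col scalerN; congr (- _).
rewrite scalemxAr scaler_sumr; congr (_ *m _); apply: eq_bigr => j _.
rewrite /zhat !scalerBr !scalerA [_ * sigma i]mulrC.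
by rewrite -[_ * `|W i j| * _]mulrA [`|_| * Num.sg _]mulrC -numEsg weight_gauge.
Qed.

Lemma is_derive_state_mx (t : R) : signal_domain tau t ->
  (forall j l, tau j l <> t%:E) ->
  is_derive t 1 state_mx (A *m state_mx t - B *m K *m (sampled_mx t *m L)).
Proof.
move=> tdom tev; apply/is_derive_mxP => a i.
have [_ _ _ /(_ i t tdom tev) dx] := x_sol.
have := is_derive_mulmxl (sigma i)%:M dx.
rewrite mulmxDr !mul_scalar_mx scalemxAr [_ *: (B *m _)]scalemxAr control_col.
move/is_derive_mxP => /(_ a 0).
under eq_fun do rewrite mul_scalar_mx.
have -> : sigma i *: x i t = col i (state_mx t) by apply/colP => b; rewrite !mxE.
rewrite mulmxN !colE !mulmxA -mulmxBl -colE [(col i _) a 0]mxE.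
rewrite [X in is_derive _ _ X _ -> _](_ : _ = fun s => state_mx s a i)//.
by apply/funext => s; rewrite !mxE.
Qed.

Lemma state_mx_within t : signal_domain tau t ->
  entrywise (fun f => {within `[0, t], continuous f}) state_mx.
Proof.
move=> tdom a i.
have [_ _ /(_ i) cx _] := x_sol.
have {}cx : {within `[0, t], continuous (x i)}.
  apply: continuous_subspaceW cx => s /=; rewrite in_itv/= => st.
  exact: signal_domain_le tdom.
have ca : {within `[0, t], continuous (fun s => x i s a 0)}.
  move=> s; exact: (cvg_comp (x i) (fun M : 'cV[R]_n => M a 0) (cx s)
    (@coord_continuous R n 1 a 0 (x i s))).
case: (fun_alg_within `[0, t]) => Cc _ CM.
rewrite (_ : (fun s => state_mx s a i) = fun s => sigma i * x i s a 0).
  exact: CM (Cc _) ca.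
by apply/funext => s; rewrite !mxE.
Qed.

Lemma state_mx_bmeas t : signal_domain tau t -> entrywise (bmeas 0 t) state_mx.
Proof. by move=> tdom a i; apply: continuous_bmeas; exact: state_mx_within. Qed.

Lemma xhat_near i t : signal_domain tau t -> (forall j l, tau j l <> t%:E) ->
  exists k, \forall s \near t, xhat A x tau i s = sampled_piece i k s.
Proof.
move=> [t0 tl] tev; have [k tk] := tl i; exists k.
apply: filterS (is_latest_near (tau0 i) (tau_le i) tk (tev i)) => s.
exact: xhat_sampled_piece.
Qed.

Lemma sampled_mx_cont (t : R) : signal_domain tau t -> (forall j l, tau j l <> t%:E) ->
  entrywise (fun f => {for t, continuous f}) sampled_mx.
Proof.
move=> tdom tev a i; have [k near_k] := xhat_near i tdom tev.
have c1 : {for t, continuous (fun s => sigma i * sampled_piece i k s a 0)}.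
  case: (fun_alg_cont t) => Cc _ CM; apply: CM; first exact: Cc.
  exact: (is_derive_continuous (is_derive_sampled_piece i k t)).
have E : \forall s \near t, sigma i * sampled_piece i k s a 0 = sampled_mx s a i.
  by apply: filterS near_k => s xs; rewrite [RHS]mxE /zhat xs [RHS]mxE.
rewrite /continuous_at /prop_for -(nbhs_singleton E).
by apply: cvg_trans c1; exact: near_eq_cvg.
Qed.

(** Up to time t, the sampled signal of agent i is the finite sum of its pieces, each
    cut off by the indicator of the times at which it is in force. *)
Lemma sampled_mx_bmeas t : signal_domain tau t -> entrywise (bmeas 0 t) sampled_mx.
Proof.
move=> tdom a i; have [t0 tl] := tdom.
pose kt := latest (tau i) t.
pose D k := [set s | is_latest (tau i) s k].
apply: (@bmeas_ext _ _ _
  (fun s => \sum_(k < kt.+1) sigma i * (\1_(D k) s * sampled_piece i k s a 0))).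
  move=> s st; have [_ /(_ i) sl] := signal_domain_le st tdom.
  have sk := latestP (tau_le i) sl.
  have kt_le : (latest (tau i) s < kt.+1)%N.
    rewrite ltnS; apply: (is_latest_le (tau_le i) (latestP (tau_le i) (tl i))).
    by rewrite (le_trans sk.1)// lee_fin; case/andP: st.
  rewrite (bigD1 (Ordinal kt_le))//= big1 => [|k /eqP kn].
    by rewrite addr0 [RHS]mxE /zhat (xhat_sampled_piece sk) [RHS]mxE indicE mem_set ?mul1r.
  rewrite indicE memNset ?mul0r ?mulr0// => sk'; apply: kn; apply/val_inj => /=.
  by rewrite (latestE (tau_le i) sk').
apply: bmeas_sum => k; apply: bmeasZ; apply: bmeasM.
  by apply: bmeas_indic; apply: measurable_is_latest.
by apply: continuous_bmeas; exact: sampled_piece_within.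
Qed.

Lemma error_mx_bmeas t : signal_domain tau t -> entrywise (bmeas 0 t) error_mx.
Proof.
move=> tdom; apply: (entrywiseB (fun_alg_bmeas 0 t)).
  exact: sampled_mx_bmeas.
exact: state_mx_bmeas.
Qed.

Lemma state_mx_cont (t : R) : signal_domain tau t -> (forall j l, tau j l <> t%:E) ->
  entrywise (fun f => {for t, continuous f}) state_mx.
Proof. by move=> tdom tev; exact: is_derive_continuous (is_derive_state_mx tdom tev). Qed.

Lemma error_mx_cont (t : R) : signal_domain tau t -> (forall j l, tau j l <> t%:E) ->
  entrywise (fun f => {for t, continuous f}) error_mx.
Proof.
move=> tdom tev.
exact: (entrywiseB (fun_alg_cont t) (sampled_mx_cont tdom tev) (state_mx_cont tdom tev)).
Qed.

End Signals.

(** * The integrated triggering rule *)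

Section Trigger.
Context {R : realType} {N n m : nat}.
Variables (A : 'M[R]_n) (B : 'M[R]_(n, m)) (K : 'M[R]_(m, n)) (W : 'M[R]_N).
Variables (sigma beta : 'I_N -> R) (h : R -> R).
Variables (x : 'I_N -> R -> 'cV[R]_n) (tau : 'I_N -> nat -> \bar R).
Hypotheses (W_weights : signed_weights W) (sigma_gauge : gauge W sigma).
Hypothesis x_sol : closed_loop A B K W x tau.
Hypothesis x_trig : trigger_rule A B K W sigma beta h x tau.
Hypothesis h_cont : {within `[0, +oo[, continuous h}.
Let L := gauged_laplacian W sigma.
Let g := gfun A W sigma beta h x tau.

Let tau0 i : tau i 0%N = 0%E. Proof. by case: x_sol. Qed.
Let tau_le i k : (tau i k <= tau i k.+1)%E. Proof. by case: x_sol. Qed.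

(** The instants that a continuation drops do not precede the instant k + 1 of agent
    i, so at earlier times it has the same latest instants as the trajectory, hence
    the same sampled signals. *)
Lemma continuation_agrees i k y rho j (s : R) :
  untriggered_continuation A B K W x tau i k y rho ->
  (s%:E < tau i k.+1)%E -> signal_domain tau s ->
  [/\ exists l, is_latest (rho j) s l,
      xhat A y rho j s = xhat A x tau j s & y j s = x j s].
Proof.
move=> [y_sol rhoi rhoE yx] sk [s0 sl]; have [l tl] := sl j.
have rl : rho j l = tau j l.
  case: (rhoE j l) => // -[kl _]; have := le_lt_trans (le_trans kl tl.1) sk.
  by rewrite ltxx.
have sl' : is_latest (rho j) s l.
  split; first by rewrite rl; exact: tl.1.
  by case: (rhoE j l.+1) => [->|[_ ->]]; [exact: tl.2|exact: ltry].
have rho_le k' : (rho j k' <= rho j k'.+1)%E by case: y_sol.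
split; [by exists l| |exact: yx].
rewrite /xhat (latestE rho_le sl') (latestE (tau_le j) tl) rl yx//.
  exact: (instant_fine_ge0 (tau0 j) (tau_le j)).
rewrite -(instant_fin (tau0 j) (tau_le j) tl.1).
exact: le_lt_trans tl.1 sk.
Qed.

(** A time t at which the integral is positive along the trajectory, hence along the
    continuation, would belong to the set whose infimum is the next instant. *)
Lemma trigger_between i k (t : R) : signal_domain tau t ->
  fine (tau i k) < t -> (tau i k < +oo)%E -> (t%:E < tau i k.+1)%E ->
  intg (fine (tau i k)) t (g i) <= 0.
Proof.
move=> tdom kt tk tk1; have [y [rho [cont tauE]]] := x_trig tk.
rewrite leNgt; apply/negP => g_gt0.
suff /le_lt_trans/(_ tk1) : (tau i k.+1 <= t%:E)%E by rewrite ltxx.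
rewrite tauE.
apply: ereal_inf_lbound.
exists t; last by [].
split; [|exact: kt|].
- split=> [|j]; first by case: tdom.
  by have [] := continuation_agrees j cont tk1 tdom.
- have [_ rhoi _ _] := cont.
  rewrite /ffun rhoi leqnn -/(intg (fine (tau i k)) t _).
  rewrite (_ : intg _ _ _ = intg (fine (tau i k)) t (g i)); first exact: g_gt0.
  apply: eq_intg => s /andP[ks st].
  have sdom : signal_domain tau s.
    apply: (signal_domain_le x_sol) tdom.
    by rewrite st (le_trans _ ks)// (instant_fine_ge0 (tau0 i) (tau_le i)).
  have sk1 : (s%:E < tau i k.+1)%E by apply: le_lt_trans tk1; rewrite lee_fin.
  have eqh j : zhat A sigma y rho j s = zhat A sigma x tau j s.
    by rewrite /zhat; have [_ ->] := continuation_agrees j cont sk1 sdom.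
  have eqs j : zstate sigma y j s = zstate sigma x j s.
    by rewrite /zstate; have [_ _ ->] := continuation_agrees j cont sk1 sdom.
  rewrite /g /gfun /zerror eqh eqs.
  rewrite (eq_bigr (fun j => `|W i j| *:
    (zhat A sigma x tau i s - zhat A sigma x tau j s)))//.
  by move=> j _; rewrite !eqh.
Qed.

Lemma h_bmeas t : bmeas 0 t h.
Proof.
apply: continuous_bmeas; apply: continuous_subspaceW h_cont => s /=.
by rewrite !in_itv/= andbT => /andP[].
Qed.

Lemma cnorm2_error_bmeas i t : signal_domain tau t ->
  bmeas 0 t (fun s => cnorm2 (error_mx A sigma x tau s) i).
Proof.
move=> tdom; apply: (entrywise_cnorm2 (fun_alg_bmeas 0 t)).
exact: (error_mx_bmeas sigma x_sol).
Qed.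

Lemma cnorm2_diffusion_bmeas i t : signal_domain tau t ->
  bmeas 0 t (fun s => cnorm2 (sampled_mx A sigma x tau s *m L) i).
Proof.
move=> tdom; apply: (entrywise_cnorm2 (fun_alg_bmeas 0 t)).
apply: (entrywiseM (fun_alg_bmeas 0 t)); first exact: (sampled_mx_bmeas sigma x_sol).
exact: (entrywise_cst (fun_alg_bmeas 0 t)).
Qed.

Lemma gfun_bmeas i t : signal_domain tau t -> bmeas 0 t (g i).
Proof.
move=> tdom; apply: bmeas_ext (bmeasB (bmeasB (cnorm2_error_bmeas i tdom)
  (bmeasZ (beta i) (cnorm2_diffusion_bmeas i tdom))) (bmeasZ (beta i) (h_bmeas t))).
by move=> s _; rewrite /g gfunE.
Qed.

(** The integrals between consecutive instants add up. Between two instants the bound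
    is the triggering rule, and at the next instant it follows by continuity of the
    integral in its upper end. *)
Lemma trigger_total i t : signal_domain tau t -> intg 0 t (g i) <= 0.
Proof.
suff H k : forall s, signal_domain tau s -> (s%:E <= tau i k)%E ->
    intg 0 s (g i) <= 0.
  move=> tdom; have [k tk] := tdom.2 i.
  by apply: (H k.+1) => //; exact: ltW tk.2.
elim: k => [s [s0 _]|k ih s sdom sk].
  rewrite tau0 lee_fin => s0'.
  by rewrite (@le_anti _ _ s 0) ?intg_point// s0 s0'.
have [/ih|ks] := leP s%:E (tau i k); first exact.
have kfin : tau i k = (fine (tau i k))%:E.
  exact: (instant_fin (tau0 i) (tau_le i) (ltW ks)).
have r0 : 0 <= fine (tau i k) by exact: (instant_fine_ge0 (tau0 i) (tau_le i)).
move: ks; rewrite kfin lte_fin => rs.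
have koo : (tau i k < +oo)%E by rewrite kfin ltry.
have rdom : signal_domain tau (fine (tau i k)).
  by apply: (signal_domain_le x_sol) sdom; rewrite r0 ltW.
have step u : signal_domain tau u -> fine (tau i k) < u ->
    (u%:E < tau i k.+1)%E -> intg 0 u (g i) <= 0.
  move=> udom ru uk1.
  rewrite (@intg_split _ 0 (fine (tau i k))) ?r0 ?(ltW ru)//; last exact: gfun_bmeas.
  rewrite -[leRHS]addr0 lerD//; last exact: trigger_between.
  by apply: ih => //; rewrite kfin.
move: sk; rewrite le_eqVlt => /predU1P[sE|]; last exact: step.
apply: (@le_at_right_end _ (fine (tau i k)) s (fun u => intg 0 u (g i))) => //.
  apply: (@continuous_subspaceW _ _ _ `[0, s]).
    by apply: subset_itv; rewrite bnd_simp.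
  by apply: intg_continuous; [case: sdom|exact: gfun_bmeas].
move=> u /andP[ru us]; apply: step => //; last by rewrite -sE lte_fin.
by apply: (signal_domain_le x_sol) sdom; rewrite (ltW us) (le_trans r0)// ltW.
Qed.

End Trigger.

(** * Centering *)

Section Averaging.
Context {R : realType} {N : nat}.
Variables (L : 'M[R]_N).
Hypotheses (L_sym : L^T = L) (L1 : L *m const_mx 1 = 0 :> 'cV_N).

(** Orthogonal projection onto the sum-zero vectors. *)
Definition centering_mx : 'M[R]_N := 1%:M - N%:R^-1 *: const_mx 1.

Lemma mul_centering_mx : L *m centering_mx = L.
Proof.
rewrite mulmxBr mulmx1 -scalemxAr (_ : L *m const_mx 1 = 0) ?scaler0 ?subr0//.
apply/matrixP => i j; have /matrixP/(_ i 0) := L1; rewrite !mxE => {2}<-.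
by apply: eq_bigr => k _; rewrite !mxE.
Qed.

Lemma centering_mx_sym : centering_mx^T = centering_mx.
Proof. by rewrite linearB/= linearZ/= trmx1 trmx_const. Qed.

Lemma centering_mx_mul : centering_mx *m L = L.
Proof. by rewrite -[LHS]trmxK trmx_mul centering_mx_sym L_sym mul_centering_mx L_sym. Qed.

Lemma centering_mx1 : (0 < N)%N -> centering_mx *m const_mx 1 = 0 :> 'cV_N.
Proof.
move=> N0; apply/matrixP => i j; rewrite mulmxBl mul1mx -scalemxAl !mxE.
under eq_bigr do rewrite !mxE mulr1.
by rewrite sumr_const card_ord mulVf ?subrr// pnatr_eq0 -lt0n.
Qed.

End Averaging.

(** * Small gain *)

(** E, Y and D stand for the integrals of the squared error, diffusion and
    disagreement. Eliminating Y and D from the three inequalities leaves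
    (b c - 2 l2 bm (b c + 1)) E <= constant, and the bound on bm says that the factor
    is positive. That l2 is not 0 is also a consequence of it, as 1 / 0 = 0. *)
Lemma small_gain (R : realFieldType) (l2 b c bm V0 n : R) :
  0 < b -> 0 < c -> 0 <= l2 -> 0 < bm -> 0 <= n ->
  bm < Num.min (1 / (2 * l2)) (b * c / (2 * l2 * (b * c + 1))) ->
  exists CE CY : R, forall E Y D : R,
    E <= bm * (Y + n) -> Y <= 2 * l2 * (D + E) -> b * D <= V0 + E / c ->
    E <= CE /\ Y <= CY.
Proof.
move=> b0 c0 l20 bm0 n0; rewrite lt_min => /andP[h1 h2].
have l2p : 0 < l2.
  rewrite lt0r l20 andbT; apply/eqP => l2E.
  by move: h1; rewrite l2E mulr0 invr0 mulr0 ltNge ltW.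
have bc0 : 0 < b * c by rewrite mulr_gt0.
have gap0 : 0 < b * c - 2 * l2 * bm * (b * c + 1).
  have den : 0 < 2 * l2 * (b * c + 1) by rewrite !mulr_gt0// addr_gt0.
  move: h2; rewrite (ltr_pdivlMr _ _ den) subr_gt0.
  by rewrite (_ : bm * _ = 2 * l2 * bm * (b * c + 1)); last by ring.
set gp := _ - _ in gap0.
pose CE := (2 * l2 * bm * (c * V0) + b * c * bm * n) / gp.
exists CE, (2 * l2 * ((V0 + CE / c) / b + CE)) => E Y D hE hY hD.
have EC : E <= CE.
  rewrite ler_pdivlMr//.
  have e1 : E <= bm * (2 * l2 * (D + E) + n).
    by apply: le_trans hE _; rewrite ler_pM2l// lerD2r.
  have e2 : b * c * E <= b * c * (bm * (2 * l2 * (D + E) + n)) by rewrite ler_pM2l.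
  have e3 : c * (b * D) <= c * V0 + E.
    have := hD; rewrite -(ler_pM2l c0) => /le_trans; apply.
    by rewrite mulrDr [c * (E / c)]mulrC divfK// gt_eqF.
  have e4 : 2 * l2 * bm * (c * (b * D)) <= 2 * l2 * bm * (c * V0 + E).
    by rewrite ler_wpM2l// !mulr_ge0// ltW.
  rewrite /gp; nra.
split => //; apply: le_trans hY _; rewrite ler_wpM2l ?mulr_ge0//.
rewrite lerD// ler_pdivlMr// mulrC (le_trans hD)// lerD2l.
by rewrite ler_wpM2r// invr_ge0 ltW.
Qed.

(** * Boundedness of the sampling error *)

Section Main.
Context {R : realType} {N n m : nat}.
Variables (A : 'M[R]_n) (B : 'M[R]_(n, m)) (W : 'M[R]_N) (sigma : 'I_N -> R).
Variables (P : 'M[R]_n) (kappa c : R) (beta : 'I_N -> R) (h : R -> R).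
Variables (x : 'I_N -> R -> 'cV[R]_n) (tau : 'I_N -> nat -> \bar R).
Hypotheses (N_gt0 : (0 < N)%N) (W_weights : signed_weights W).
Hypotheses (W_conn : signed_connected W) (sigma_gauge : gauge W sigma).
Hypotheses (P_posdef : posdefmx P) (c_gt0 : 0 < c).
Hypothesis P_lmi : loewner_lt (A^T *m P + P *m A
  - min_pos_eigenvalue (laplacian W) *: (P *m B *m B^T *m P)) (- kappa%:M).
Hypothesis h_cont : {within `[0, +oo[, continuous h}.
Hypothesis h_gt0 : forall s : R, 0 <= s -> 0 < h s.
Hypothesis h_int :
  (\int[@lebesgue_measure R]_(s in `[0%R, +oo[) (h s)%:E = 1)%E.
Hypothesis beta_gt0 : forall i, 0 < beta i.
Hypothesis x_sol : closed_loop A B (B^T *m P) W x tau.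
Hypothesis x_trig : trigger_rule A B (B^T *m P) W sigma beta h x tau.

Let L := gauged_laplacian W sigma.
Let beta_max := \big[Num.max/0]_(i < N) beta i.
Let b := kappa - c * opnorm (L *t (P *m B *m B^T *m P)) ^+ 2.
Let Z := state_mx sigma x.
Let H := sampled_mx A sigma x tau.
Let E := error_mx A sigma x tau.
Let D (t : R) := Z t *m centering_mx.
Let V (t : R) := \tr ((D t)^T *m P *m D t).

Let L_sym : L^T = L := gauged_laplacian_sym W_weights sigma_gauge.
Let L1 : L *m const_mx 1 = 0 :> 'cV_N := gauged_laplacian_const sigma_gauge.

Lemma intg_h_le1 t : 0 <= t -> intg 0 t h <= 1.
Proof.
move=> t0; rewrite -lee_fin /intg /Rintegral fineK; last first.
  by apply: integrable_fin_num => //; exact: bmeas_integrable (h_bmeas h_cont t).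
rewrite -h_int; apply: ge0_subset_integral => //.
- apply/measurable_EFinP; exact: subspace_continuous_measurable_fun.
- by move=> s /=; rewrite in_itv/= andbT lee_fin => /h_gt0/ltW.
- by move=> s /=; rewrite !in_itv/= andbT => /andP[].
Qed.

(** The diffusion does not see the mean of the states. *)
Lemma sampled_diffusionE t : H t *m L = (D t + E t) *m L.
Proof.
rewrite /D /E /error_mx mulmxDl -mulmxA centering_mx_mul//.
by rewrite mulmxBl addrC subrK.
Qed.

Lemma fnorm2_diffusion_le t :
  fnorm2 (H t *m L) <= 2 * opnorm L ^+ 2 * (fnorm2 (D t) + fnorm2 (E t)).
Proof.
rewrite sampled_diffusionE -fnorm2_tr trmx_mul L_sym; apply: le_trans (fnorm2_mulmx _ _) _.
rewrite fnorm2_tr -mulrA mulrCA ler_wpM2l ?sqr_ge0// mulrDr; exact: fnorm2D.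
Qed.

Lemma lyapunov_step (t : R) : signal_domain tau t ->
  (forall j l, tau j l <> t%:E) -> exists2 dV, is_derive t 1 V dV &
  dV <= - b * fnorm2 (D t) + fnorm2 (E t) / c.
Proof.
move=> tdom tev.
have dZ := is_derive_state_mx W_weights sigma_gauge x_sol tdom tev.
have dD := is_derive_mulmxr centering_mx dZ.
have dDP := is_derive_mulmxr P (is_derive_trmx dD).
have dV := is_derive_mxtrace (is_derive_mulmx dDP dD).
eexists; first exact: dV.
rewrite /b; apply: (@lyapunov_derivative_le _ _ _ _ A B P _ L kappa c
  (min_pos_eigenvalue (laplacian W))) => //.
- exact: min_pos_eigenvalue_ge0.
- by move=> Y; exact: spectral_gap_trace.
- by rewrite -mulmxA centering_mx1// mulmx0.
- rewrite -[_ *m (D t + E t) *m L]mulmxA -sampled_diffusionE mulmxBl -[A *m _ *m _]mulmxA.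
  by rewrite -[_ *m (_ *m L) *m _]mulmxA -[H t *m L *m _]mulmxA mul_centering_mx.
Qed.

Lemma disagreement_bmeas t : signal_domain tau t -> entrywise (bmeas 0 t) D.
Proof.
move=> tdom; apply: (entrywiseM (fun_alg_bmeas 0 t)).
  exact: (state_mx_bmeas sigma x_sol).
exact: (entrywise_cst (fun_alg_bmeas 0 t)).
Qed.

Lemma lyapunov_decrease t : signal_domain tau t ->
  V t - V 0 <= - b * intg 0 t (fun s => fnorm2 (D s))
             + intg 0 t (fun s => fnorm2 (E s)) / c.
Proof.
move=> tdom.
have fD : bmeas 0 t (fun s => fnorm2 (D s)).
  exact: (entrywise_fnorm2 (fun_alg_bmeas 0 t) (disagreement_bmeas tdom)).
have fE : bmeas 0 t (fun s => fnorm2 (E s)).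
  exact: (entrywise_fnorm2 (fun_alg_bmeas 0 t) (error_mx_bmeas sigma x_sol tdom)).
rewrite [_ / c]mulrC -!intgZ// -intgD; try exact: bmeasZ.
have [S S_ev] := event_times x_sol tdom.
apply: (@le_increment_intg _ 0 t V ('D_1 V) _ S).
- by case: tdom.
- have Dw : entrywise (fun f => {within `[0, t], continuous f}) D.
    apply: (entrywiseM (fun_alg_within `[0, t])); first exact: (state_mx_within x_sol).
    exact: (entrywise_cst (fun_alg_within `[0, t])).
  apply: (entrywise_trace (fun_alg_within `[0, t])).
  apply: (entrywiseM (fun_alg_within `[0, t])) => //.
  apply: (entrywiseM (fun_alg_within `[0, t])); first exact: entrywise_tr.
  exact: (entrywise_cst (fun_alg_within `[0, t])).
- by apply: bmeasD; exact: bmeasZ.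
move=> s /andP[s0 st] sS; have tev := S_ev s (ltW st) sS.
have sdom : signal_domain tau s.
  by apply: (signal_domain_le x_sol) tdom; rewrite !ltW.
have [dV dVs dV_le] := lyapunov_step sdom tev.
split; first by apply: DeriveDef => //; have [] := dVs.
  by have [_ ->] := dVs; rewrite [_^-1 * _]mulrC.
have Dc : entrywise (fun f => {for s, continuous f}) D.
  apply: (entrywiseM (fun_alg_cont s)).
    exact: (state_mx_cont W_weights sigma_gauge x_sol).
  exact: (entrywise_cst (fun_alg_cont s)).
have Ec : entrywise (fun f => {for s, continuous f}) E.
  exact: (error_mx_cont W_weights sigma_gauge x_sol).
have [Cc CD CM] := fun_alg_cont s.
apply: CD; (apply: CM; first exact: Cc).
  exact: (entrywise_fnorm2 (fun_alg_cont s)).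
exact: (entrywise_fnorm2 (fun_alg_cont s)).
Qed.

(** The sum over the agents of the integrated triggering rules; the integral of h is
    at most 1 for each of the N agents. *)
Lemma intg_error_le t : signal_domain tau t ->
  intg 0 t (fun s => fnorm2 (E s)) <=
  beta_max * (intg 0 t (fun s => fnorm2 (H s *m L)) + N%:R).
Proof.
move=> tdom; have t0 : 0 <= t by case: tdom.
have bE i : bmeas 0 t (fun s => cnorm2 (E s) i) by exact: (cnorm2_error_bmeas sigma x_sol).
have bH i : bmeas 0 t (fun s => cnorm2 (H s *m L) i).
  exact: (cnorm2_diffusion_bmeas sigma x_sol).
rewrite (@intg_sum _ 0 t _ _ (fun i s => cnorm2 (E s) i))//.
rewrite (@intg_sum _ 0 t _ _ (fun i s => cnorm2 (H s *m L) i))//.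
rewrite mulrDr mulr_sumr -[N in N%:R]card_ord -sumr_const mulr_sumr -big_split/=.
apply: ler_sum => i _.
have bh := h_bmeas h_cont t.
have := trigger_total W_weights sigma_gauge x_sol x_trig h_cont i tdom.
rewrite (@eq_intg _ 0 t _ (fun s => cnorm2 (E s) i
  - beta i * cnorm2 (H s *m L) i - beta i * h s)); last first.
  by move=> s _; rewrite (gfunE A beta h x tau W_weights sigma_gauge).
have bEH : bmeas 0 t (fun s => cnorm2 (E s) i - beta i * cnorm2 (H s *m L) i).
  by apply: bmeasB => //; exact: bmeasZ.
rewrite (intgB bEH (bmeasZ _ bh)) (intgB (bE i) (bmeasZ _ (bH i))) !intgZ//.
move=> gle.
have bi : beta i <= beta_max by exact: le_bigmax.
have := ler_wpM2l (ltW (beta_gt0 i)) (intg_h_le1 t0).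
have : 0 <= intg 0 t (fun s => cnorm2 (H s *m L) i).
  by apply: intg_ge0 => s _; exact: cnorm2_ge0.
by move=> y0 hle; have := ler_wpM2r y0 bi; lra.
Qed.

(** The three integral inequalities close up by the small gain condition, with
    constants that do not depend on t. *)
Lemma integral_bounds : 0 < b ->
  beta_max < Num.min (1 / (2 * opnorm L ^+ 2))
                     (b * c / (2 * opnorm L ^+ 2 * (b * c + 1))) ->
  exists CE CY : R, forall t, signal_domain tau t ->
    intg 0 t (fun s => fnorm2 (E s)) <= CE /\
    intg 0 t (fun s => fnorm2 (H s *m L)) <= CY.
Proof.
move=> b0 hbeta.
have bm0 : 0 < beta_max.
  exact: lt_le_trans (beta_gt0 (Ordinal N_gt0)) (le_bigmax _ _ _).
have [CE [CY bnd]] := small_gain (V 0) b0 c_gt0 (sqr_ge0 _) bm0 (ler0n R N) hbeta.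
exists CE, CY => t tdom.
have bD : bmeas 0 t (fun s => fnorm2 (D s)).
  exact: (entrywise_fnorm2 (fun_alg_bmeas 0 t) (disagreement_bmeas tdom)).
have bE : bmeas 0 t (fun s => fnorm2 (E s)).
  exact: (entrywise_fnorm2 (fun_alg_bmeas 0 t) (error_mx_bmeas sigma x_sol tdom)).
have bH : bmeas 0 t (fun s => fnorm2 (H s *m L)).
  by apply: bmeas_sum => i; exact: (cnorm2_diffusion_bmeas sigma x_sol).
apply: (bnd _ _ (intg 0 t (fun s => fnorm2 (D s)))).
- exact: intg_error_le.
- rewrite -intgD// -intgZ; last exact: bmeasD.
  apply: le_intg => //; first exact/bmeasZ/bmeasD.
  by move=> s _; exact: fnorm2_diffusion_le.
- have Vt : 0 <= V t by apply: trace_form_ge0 => v; exact: posdefmx_ge0.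
  by have := lyapunov_decrease tdom; lra.
Qed.

(** The error of agent i vanishes at its latest instant, and from then on satisfies
    e' = A e + B B^T P w where w is its diffusion term. Integrating the derivative of
    |e|^2, which is at most (1 + 2 |A|^2) |e|^2 + 2 |B B^T P|^2 |w|^2, from that
    instant to t bounds |e|^2 by integrals that only grow when taken from 0 on. *)
Lemma error_growth i t : signal_domain tau t ->
  cnorm2 (E t) i <=
  (1 + 2 * opnorm A ^+ 2) * intg 0 t (fun s => cnorm2 (E s) i) +
  2 * opnorm (B *m (B^T *m P)) ^+ 2 * intg 0 t (fun s => cnorm2 (H s *m L) i).
Proof.
move=> tdom.
have tau0 : tau i 0%N = 0%E by case: x_sol.
have tau_le k : (tau i k <= tau i k.+1)%E by case: x_sol.
have [k tk] := tdom.2 i.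
set r := fine (tau i k).
have r0 : 0 <= r by exact: (instant_fine_ge0 tau0 tau_le).
have kr : tau i k = r%:E by exact: (instant_fin tau0 tau_le tk.1).
have rt : r <= t by rewrite -lee_fin -kr; exact: tk.1.
pose M (s : R) : 'cV[R]_n := sigma i *: sampled_piece A x tau i k s - col i (Z s).
have ME s : r <= s <= t -> M s = col i (E s).
  move=> /andP[rs st]; have sk : is_latest (tau i) s k.
    by split; [rewrite kr lee_fin|rewrite (le_lt_trans _ tk.2)// lee_fin].
  apply/colP => a; rewrite /M -(xhat_sampled_piece x_sol sk).
  by rewrite !mxE.
have Mr : cnorm2 (M r) 0 = 0.
  rewrite /M /sampled_piece -/r subrr expmx0 mul1mx.
  by apply: big1 => a _; rewrite !mxE subrr expr0n.
have bE : bmeas 0 t (fun s => cnorm2 (E s) i) by exact: (cnorm2_error_bmeas sigma x_sol).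
have bH : bmeas 0 t (fun s => cnorm2 (H s *m L) i).
  exact: (cnorm2_diffusion_bmeas sigma x_sol).
set cA := 1 + _; set cB := 2 * _.
have cA0 : 0 <= cA by rewrite addr_ge0// mulr_ge0 ?sqr_ge0.
have cB0 : 0 <= cB by rewrite mulr_ge0 ?sqr_ge0.
pose G s := cA * cnorm2 (E s) i + cB * cnorm2 (H s *m L) i.
have bG : bmeas 0 t G by apply: bmeasD; exact: bmeasZ.
rewrite -!intgZ// -intgD; try exact: bmeasZ.
apply: (@le_trans _ _ (intg r t G)); last first.
  apply: le_intg_sub => // s _.
  by apply: addr_ge0; rewrite mulr_ge0 ?cnorm2_ge0.
rewrite -cnorm2_col -ME ?rt ?lexx// -[leLHS]subr0 -Mr.
have [S S_ev] := event_times x_sol tdom.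
apply: (@le_increment_intg _ r t (fun s => cnorm2 (M s) 0)
  ('D_1 (fun s => cnorm2 (M s) 0)) G S) => //.
- apply: (entrywise_cnorm2 (fun_alg_within `[r, t])).
  apply: (entrywiseB (fun_alg_within `[r, t])).
    have := entrywiseM (fun_alg_within `[r, t])
      (entrywise_cst (fun_alg_within `[r, t]) (sigma i)%:M)
      (@sampled_piece_within R N n A x tau i k `[r, t]).
    move=> Hx a j; have := Hx a j.
    rewrite (_ : (fun s => (_ *m _) a j) =
      fun s => (sigma i *: sampled_piece A x tau i k s) a j)//.
    by apply/funext => s; rewrite mul_scalar_mx.
  move=> a j; rewrite (_ : (fun _ => _) = (fun s => Z s a i)); last first.
    by apply/funext => s; rewrite mxE.
  have Zw : {within `[0, t], continuous (fun s => Z s a i)}.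
    exact: (state_mx_within x_sol).
  apply: continuous_subspaceW Zw.
  by apply: subset_itv; rewrite bnd_simp.
- exact: bmeasS bG.
move=> s /andP[rs st] sS; have tev := S_ev s (ltW st) sS.
have sdom : signal_domain tau s.
  by apply: (signal_domain_le x_sol) tdom; rewrite (le_trans r0)// ltW.
have dZ := is_derive_state_mx W_weights sigma_gauge x_sol sdom tev.
pose w := col i (H s *m L).
pose dM := A *m M s + B *m (B^T *m P) *m w.
have dMs : is_derive s 1 M dM.
  have dX := is_derive_mulmxl (sigma i)%:M (is_derive_sampled_piece A x tau i k s).
  have dC := is_derive_mulmxr (delta_mx i (0 : 'I_1)) dZ.
  have := is_deriveB dX dC.
  rewrite (_ : _ - _ = M); last first.
    by apply/funext => u; rewrite /M colE -mul_scalar_mx.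
  rewrite (_ : _ - _ = dM)// /dM /w /M !colE mulmxBl opprB !mul_scalar_mx.
  by rewrite mulmxBr -scalemxAr !mulmxA addrA [RHS]addrAC -addrA.
have dF : is_derive s 1 (fun u => cnorm2 (M u) 0)
    ((dM^T *m M s + (M s)^T *m dM) 0 0).
  under eq_fun do rewrite cnorm2_tr.
  by have /is_derive_mxP := is_derive_mulmx (is_derive_trmx dMs) dMs; exact.
split.
- by apply: DeriveDef => //; have [] := dF.
- have [_ ->] := dF.
  have -> : (dM^T *m M s + (M s)^T *m dM) 0 0 = - 2 * \tr ((- M s)^T *m dM).
    rewrite linearN/= mulNmx linearN/= mulrNN mulr2n mulrDl mul1r /mxtrace big_ord1.
    rewrite mxE; congr (_ + _).
    have tr11 (X : 'M[R]_1) : X 0 0 = X^T 0 0 by rewrite mxE.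
    by rewrite tr11 trmx_mul trmxK.
  have f1 (v : 'cV[R]_n) : fnorm2 v = cnorm2 v 0 by rewrite /fnorm2 big_ord1.
  apply: le_trans (young_trace _ _ ltr01) _.
  rewrite mul1r divr1 !f1 /G.
  have -> : cnorm2 (- M s) 0 = cnorm2 (M s) 0.
    by apply: eq_bigr => a _; rewrite mxE sqrrN.
  have ->: cnorm2 (E s) i = cnorm2 (M s) 0.
    by rewrite ME ?cnorm2_col// !ltW.
  have := cnorm2D (A *m M s) (B *m (B^T *m P) *m w) 0.
  have := cnorm2_mulmx A (M s) 0.
  have := cnorm2_mulmx (B *m (B^T *m P)) w 0.
  rewrite /w cnorm2_col /G /cA /cB; rewrite -/w -/dM; lra.
- have [Cc CD CM] := fun_alg_cont s.
  have Ec : entrywise (fun f => {for s, continuous f}) E.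
    exact: (error_mx_cont W_weights sigma_gauge x_sol).
  apply: CD; (apply: CM; first exact: Cc); apply: (entrywise_cnorm2 (fun_alg_cont s)) => //.
  apply: (entrywiseM (fun_alg_cont s)); first exact: (sampled_mx_cont x_sol).
  exact: (entrywise_cst (fun_alg_cont s)).
Qed.

End Main.
Theorem mainTheorem3 (R : realType) (N n m : nat)
  (A : 'M[R]_n) (B : 'M[R]_(n, m)) (W : 'M[R]_N) (sigma : 'I_N -> R)
  (P : 'M[R]_n) (kappa c : R) (beta : 'I_N -> R) (h : R -> R)
  (x : 'I_N -> R -> 'cV[R]_n) (tau : 'I_N -> nat -> \bar R)
  (N_ge2 : (2 <= N)%N)
  (AB_stab : stabilizable A B)
  (W_weights : signed_weights W)
  (W_conn : signed_connected W)
  (W_bal : structurally_balanced W)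
  (sigma_gauge : gauge W sigma)
  (kappa_gt0 : 0 < kappa)
  (P_posdef : posdefmx P)
  (P_lmi : loewner_lt (A^T *m P + P *m A
                 - min_pos_eigenvalue (laplacian W) *: (P *m B *m B^T *m P))
                (- kappa%:M))
  (h_cont : {within `[0, +oo[, continuous h})
  (h_gt0 : forall s : R, 0 <= s -> 0 < h s)
  (h_int : (\int[@lebesgue_measure R]_(s in `[0%R, +oo[) (h s)%:E = 1)%E)
  (beta_gt0 : forall i, 0 < beta i)
  (c_gt0 : 0 < c) :
  let LD := gauged_laplacian W sigma in
  let beta_max := \big[Num.max/0]_(i < N) beta i in
  let b := kappa - c * opnorm (LD *t (P *m B *m B^T *m P)) ^+ 2 in
  0 < b ->
  beta_max < Num.min (1 / (2 * opnorm LD ^+ 2))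
                     (b * c / (2 * opnorm LD ^+ 2 * (b * c + 1))) ->
  closed_loop A B (B^T *m P) W x tau ->
  trigger_rule A B (B^T *m P) W sigma beta h x tau ->
  forall i : 'I_N, exists M : R, forall t : R, signal_domain tau t ->
    enorm (zhat A sigma x tau i t - zstate sigma x i t) <= M.
Proof.
move=> LD beta_max b b_gt0 beta_small x_sol x_trig i.
have [CE [CY bnd]] := integral_bounds (ltnW N_ge2) W_weights W_conn sigma_gauge
  P_posdef c_gt0 P_lmi h_cont h_gt0 h_int beta_gt0 x_sol x_trig b_gt0 beta_small.
exists (Num.sqrt ((1 + 2 * opnorm A ^+ 2) * CE +
                  2 * opnorm (B *m (B^T *m P)) ^+ 2 * CY)) => t tdom.
have [hE hY] := bnd t tdom.
have bE j : bmeas 0 t (fun s => cnorm2 (error_mx A sigma x tau s) j).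
  exact: (cnorm2_error_bmeas sigma x_sol).
have bH j : bmeas 0 t (fun s => cnorm2 (sampled_mx A sigma x tau s *m LD) j).
  exact: (cnorm2_diffusion_bmeas sigma x_sol).
have hEi : intg 0 t (fun s => cnorm2 (error_mx A sigma x tau s) i) <= CE.
  apply: le_trans hE; apply: le_intg => [//||s _]; last exact: cnorm2_le_fnorm2.
  exact: bmeas_sum.
have hYi : intg 0 t (fun s => cnorm2 (sampled_mx A sigma x tau s *m LD) i) <= CY.
  apply: le_trans hY; apply: le_intg => [//||s _]; last exact: cnorm2_le_fnorm2.
  exact: bmeas_sum.
apply: ler_wsqrtr.
rewrite [leLHS](_ : _ = cnorm2 (error_mx A sigma x tau t) i); last first.
  by apply: eq_bigr => a _; rewrite !mxE.
apply: le_trans (error_growth W_weights sigma_gauge x_sol i tdom) _.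
apply: lerD; apply: ler_wpM2l => //.
  by rewrite addr_ge0// mulr_ge0// sqr_ge0.
by rewrite mulr_ge0// sqr_ge0.
Qed.
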